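(* Let $n\ge0$ be an integer. For every $0\le t<1$ and $x\in\mathbb{R}$, $$J(t,x):=\sup_{t\le\tau_1\le\tau_2<1}\mathbb{E}_{t,x}\Big[(X_{\tau_2}^{2n+1}-X_{\tau_1}^{2n+1})1_{\{X_{\tau_1}\le0\}}+(X_{\tau_1}^{2n+1}-X_{\tau_2}^{2n+1})1_{\{X_{\tau_1}>0\}}\Big]$$ equals $J^*(t,x)$, where $$J^*(t,x)=\begin{cases}(1-t)^{n+1/2}(F_{2n+1}+G_{2n+1})\big(x/\sqrt{1-t}\big)\,j(B^* ), & |x|<B^*\sqrt{1-t},\\ g(t,x), & |x|\ge B^*\sqrt{1-t}.\end{cases}$$ Moreover, optimal stopping times are $\tau_1^*:=\inf\{s\ge t:|X_s|\ge B^*\sqrt{1-s}\}$ and $$\tau_2^*:=\begin{cases}\inf\{s\ge\tau_1^*: X_s\ge B^*\sqrt{1-s}\}, & \text{if } X_{\tau_1^*}\le -B^*\sqrt{1-\tau_1^*},\\ \inf\{s\ge\tau_1^*: X_s\le -B^*\sqrt{1-s}\}, & \text{if } X_{\tau_1^*}\ge B^*\sqrt{1-\tau_1^*}.\end{cases}$$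
   Context: For $0\le t<1$ and $x\in\mathbb{R}$, let $\{X_s\}_{t\le s\le1}$ be the Brownian bridge solving $\mathrm{d}X_s=-\frac{X_s}{1-s}\mathrm{d}s+\mathrm{d}W_s$ for $t\le s<1$, with $X_t=x$. Here $W$ is a standard Brownian motion. Write $\mathbb{E}_{t,x}$ for expectation under $X_t=x$. Stopping times are with respect to the filtration generated by $X$, and the supremum is over pairs $t\le\tau_1\le\tau_2<1$ a.s. For $q>0$ let $F_q(y):=\int_0^\infty u^{q-1}e^{yu-u^2/2}\,\mathrm{d}u$ and $G_q(y):=F_q(-y)$, $y\in\mathbb{R}$. $B^*>0$ is the unique zero of the strictly decreasing function $B\mapsto(2n+1)-BF'_{2n+1}(B)/F_{2n+1}(B)$. Equivalently, it is the maximizer of $B\mapsto B^{2n+1}/F_{2n+1}(B)$. Define $U(t,x)=(1-t)^{n+1/2}(B^* )^{2n+1}F_{2n+1}(x/\sqrt{1-t})/F_{2n+1}(B^* )$ if $x<B^*\sqrt{1-t}$, and $U(t,x)=x^{2n+1}$ otherwise. Set $$g(t,x):=(U(t,x)-x^{2n+1})1_{\{x\le0\}}+(U(t,-x)+x^{2n+1})1_{\{x>0\}}.$$ For $D\ge0$ let $$j(D):=\frac{1}{(F_{2n+1}+G_{2n+1})(D)}\left[D^{2n+1}+(B^* )^{2n+1}\frac{G_{2n+1}(D)}{F_{2n+1}(B^* )}\right].$$ *)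

(* Defs.v *)
From HB Require Import structures.
From mathcomp Require Import all_boot all_order all_algebra.
From mathcomp Require Import all_classical all_reals all_analysis.
Set Implicit Arguments. Unset Strict Implicit. Unset Printing Implicit Defensive.
Import Order.TTheory GRing.Theory Num.Theory Num.Def.
Import numFieldNormedType.Exports.
Local Open Scope classical_set_scope.
Local Open Scope ring_scope.

Section defs.
Context {R : realType}.

(* F_q(y) = \int_0^oo u^(q-1) e^(y u - u^2/2) du  (only integer q >= 1 is used) *)
Definition Fq (q : nat) (y : R) : R :=
  Rintegral lebesgue_measure `[0%R, +oo[
    (fun u => u ^+ q.-1 * expR (y * u - u ^+ 2 / 2)).

Definition Gq (q : nat) (y : R) : R := Fq q (- y).

Definition Ufun (n : nat) (Bs t x : R) : R :=
  if x < Bs * Num.sqrt (1 - t) then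
    (1 - t) `^ (n%:R + 2^-1) * Bs ^+ (2 * n + 1) * Fq (2 * n + 1) (x / Num.sqrt (1 - t))
      / Fq (2 * n + 1) Bs
  else x ^+ (2 * n + 1).

Definition gfun (n : nat) (Bs t x : R) : R :=
  if x <= 0 then Ufun n Bs t x - x ^+ (2 * n + 1)
  else Ufun n Bs t (- x) + x ^+ (2 * n + 1).

Definition jfun (n : nat) (Bs D : R) : R :=
  (Fq (2 * n + 1) D + Gq (2 * n + 1) D)^-1 *
  (D ^+ (2 * n + 1) + Bs ^+ (2 * n + 1) * Gq (2 * n + 1) D / Fq (2 * n + 1) Bs).

Definition Jstar (n : nat) (Bs t x : R) : R :=
  if `|x| < Bs * Num.sqrt (1 - t) then
    (1 - t) `^ (n%:R + 2^-1) *
    (Fq (2 * n + 1) (x / Num.sqrt (1 - t)) + Gq (2 * n + 1) (x / Num.sqrt (1 - t)))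
    * jfun n Bs Bs
  else gfun n Bs t x.

Context {d : measure_display} {Omega : measurableType d}.

Definition is_std_BM (P : probability Omega R) (W : R -> Omega -> R) : Prop :=
  [/\ (forall s, measurable_fun setT (W s)),
      (forall w, W 0 w = 0),
      (forall w, {within `[0%R, +oo[, continuous (fun s => W s w)}) &
      (forall (k : nat) (s : nat -> R) (A : nat -> set R),
          0 <= s 0%N ->
          (forall i, (i < k)%N -> s i < s i.+1) ->
          (forall i, (i < k)%N -> measurable (A i)) ->
          P (\bigcap_(i in [set i | (i < k)%N])
               [set w | A i (W (s i.+1) w - W (s i) w)])
          = \big[*%E/1%E]_(i < k) normal_prob 0 (Num.sqrt (s i.+1 - s i)) (A i))].

(* X solves dX_s = - X_s/(1-s) ds + dW_s on [t,1) with X_t = x, pathwise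
   (integral form; the diffusion coefficient is constant). *)
Definition is_bridge (W : R -> Omega -> R) (t x : R) (X : R -> Omega -> R) : Prop :=
  forall w,
    X t w = x /\
    {within `[t, 1%R[, continuous (fun s => X s w)} /\
    (forall s, t <= s < 1 ->
       X s w = x - Rintegral lebesgue_measure `[t, s] (fun u => X u w / (1 - u))
                 + (W s w - W t w)).

Definition natfil (X : R -> Omega -> R) (t s : R) : set (set Omega) :=
  <<s [set A | exists u (B : set R), [/\ t <= u <= s, measurable B & A = X u @^-1` B]] >>.

Definition is_stopping_time (X : R -> Omega -> R) (t : R) (tau : Omega -> R) : Prop :=
  forall s, t <= s < 1 -> natfil X t s [set w | tau w <= s].

Definition admissible (P : probability Omega R) (X : R -> Omega -> R) (t : R)
    (tau1 tau2 : Omega -> R) : Prop :=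
  [/\ is_stopping_time X t tau1, is_stopping_time X t tau2 &
      {ae P, forall w, t <= tau1 w /\ tau1 w <= tau2 w /\ tau2 w < 1}].

Definition payoff (n : nat) (X : R -> Omega -> R) (tau1 tau2 : Omega -> R) (w : Omega) : R :=
  let a := X (tau1 w) w in let b := X (tau2 w) w in
  if a <= 0 then b ^+ (2 * n + 1) - a ^+ (2 * n + 1)
  else a ^+ (2 * n + 1) - b ^+ (2 * n + 1).

Definition expected_payoff (P : probability Omega R) n X (tau1 tau2 : Omega -> R) : \bar R :=
  (\int[P]_w (payoff n X tau1 tau2 w)%:E)%E.

Definition Jvalue (P : probability Omega R) n X t : \bar R :=
  ereal_sup [set v | exists tau1 tau2,
      admissible P X t tau1 tau2 /\ v = expected_payoff P n X tau1 tau2].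

Definition hit (a : R) (C : R -> Prop) : R :=
  if `[< exists s, a <= s < 1 /\ C s >] then inf [set s | a <= s < 1 /\ C s] else 1.

Definition tau1star (Bs t : R) (X : R -> Omega -> R) (w : Omega) : R :=
  hit t (fun s => Bs * Num.sqrt (1 - s) <= `|X s w|).

Definition tau2star (Bs t : R) (X : R -> Omega -> R) (w : Omega) : R :=
  let r := tau1star Bs t X w in
  if X r w <= - (Bs * Num.sqrt (1 - r))
  then hit r (fun s => Bs * Num.sqrt (1 - s) <= X s w)
  else hit r (fun s => X s w <= - (Bs * Num.sqrt (1 - s))).

End defs.

(* Main.v *)
Require Import Defs.
From HB Require Import structures.
From mathcomp Require Import all_boot all_order all_algebra.
From mathcomp Require Import all_classical all_reals all_analysis.
From mathcomp Require Import measurable_realfun ring lra.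
Set Implicit Arguments. Unset Strict Implicit. Unset Printing Implicit Defensive.
Import Order.TTheory GRing.Theory Num.Theory Num.Def.
Import numFieldNormedType.Exports.
Local Open Scope classical_set_scope.
Local Open Scope ring_scope.

(** A pair (tau1, tau2) amounts to two stopping times, the sale time sigma and
    the short-sale time sigma', with payoff X_sigma^m + (-X_sigma')^m, m = 2n+1.
    As j(B) = B^m / F(B), the candidate value is J*(t,x) = U(t,x) + U(t,-x), so
    the problem splits into two one-sided stopping problems.

    With v = 1/(1-s) and z = X_s/(1-s), the processes exp(l z - l^2 v/2) are
    martingales in s, and integrating them against l^(m-1) dl gives
    H(v,z) = F(z/sqrt v) / sqrt v^m.  Maximality of B^m/F(B) reads
    max(X_s,0)^m <= (B^m/F(B)) H(v,z), with equality on the boundary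
    X_s = B sqrt(1-s).  Optional stopping at times bounded away from 1 gives the
    upper bound on the continuation region; beyond the boundary the clock v is
    shifted so as to put the starting point on the boundary.  The value is
    attained at the first hitting time of the boundary, which is almost surely
    less than 1: let l tend to 0 in the stopped exponential martingale.

    For the martingale property, X/(1-s) is a pathwise limit of Riemann sums of
    the independent Gaussian increments of W.
    Optional stopping passes through dyadic approximations of the stopping time,
    with a bound in L^2 for the passage to the limit. *)

(** * Measure-theoretic preliminaries *)

(** The split loses nothing because [tau1star] and [tau2star] are the minimum and the maximum of the
    hitting times of the two boundaries: sale and short sale each take place at their own one-sided
    hitting time, whichever comes first.

    The hypotheses give only a pathwise equation and the joint laws of finitely many increments of
    W. Writing X_s = (1-s) Z_s, the equation becomes dZ = dW/(1-s) with a deterministic integrand,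
    so exponentials of Z are limits of finite products of Gaussian factors. They, and not the value
    function, are therefore the basic martingales.

    Near time 1 the clock v explodes. The upper bound gets there from horizons T_j = 1 - (1-t)/2^j
    by Fatou's lemma. At the hitting time, the stopped path lies below the boundary, which dominates
    the stopped exponentials uniformly in the horizon.

    The payoff of an arbitrary pair comes with no measurability, since stopping times are
    unconstrained on a null set; it is compared almost everywhere with a measurable function.

    The equation for B only says that B is a critical point; that it is a global maximiser follows
    from Jensen's inequality for F. *)

Lemma measurable_fun_prodr d (T : measurableType d) (R : realType) (I : Type)
    (D : set T) (r : seq I) (Q : pred I) (f : I -> T -> R) :
  (forall i, Q i -> measurable_fun D (f i)) ->
  measurable_fun D (fun w => \prod_(i <- r | Q i) f i w).
Proof.
move=> mf; elim: r => [|i r IH].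
  by under eq_fun do rewrite big_nil; exact: measurable_cst.
have [Qi|Qi] := boolP (Q i); last by under eq_fun do rewrite big_cons (negbTE Qi).
under eq_fun do rewrite big_cons Qi.
by apply: measurable_funM => //; exact: mf.
Qed.

Lemma measurable_fun_sumr d (T : measurableType d) (R : realType) (I : Type)
    (D : set T) (r : seq I) (Q : pred I) (f : I -> T -> R) :
  (forall i, Q i -> measurable_fun D (f i)) ->
  measurable_fun D (fun w => \sum_(i <- r | Q i) f i w).
Proof.
move=> mf; elim: r => [|i r IH].
  by under eq_fun do rewrite big_nil; exact: measurable_cst.
have [Qi|Qi] := boolP (Q i); last by under eq_fun do rewrite big_cons (negbTE Qi).
under eq_fun do rewrite big_cons Qi.
by apply: measurable_funD => //; exact: mf.
Qed.

Section transfer.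
Context d (T : measurableType d) (R : realType).
Import HBNNSimple.

Lemma integral_weight_approx d0 (T0 : measurableType d0)
  (P0 : {measure set T0 -> \bar R}) (a : T0 -> R) (xi : T0 -> T) (f : T -> \bar R)
  (mf : measurable_fun setT f) :
  measurable_fun setT a -> (forall w, 0 <= a w) -> measurable_fun setT xi ->
  (forall x, 0 <= f x)%E ->
  (\int[P0]_w ((a w)%:E * f (xi w)) =
   limn (fun k => \sum_(y \in range (nnsfun_approx measurableT mf k))
     y%:E * \int[P0]_w (a w * \1_(nnsfun_approx measurableT mf k @^-1` [set y]) (xi w))%:E))%E.
Proof.
move=> ma a0 mxi f0.
set g := nnsfun_approx measurableT mf.
have mg k : measurable_fun setT (fun w => (a w)%:E * (g k (xi w))%:E)%E.
  apply/measurable_EFinP; apply: measurable_funM => //.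
  by apply: measurableT_comp.
transitivity (limn (fun k => \int[P0]_w ((a w)%:E * (g k (xi w))%:E)))%E.
  rewrite -monotone_convergence//.
  - apply: eq_integral => w _; apply/esym/cvg_lim => //.
    apply: cvgeZl => //.
    exact: (cvg_nnsfun_approx measurableT mf (fun x _ => f0 x) I).
  - by move=> k w _; rewrite lee_fin mulr_ge0.
  - move=> w _ i j ij; rewrite lee_fin ler_wpM2l//.
    by have /lefP := nd_nnsfun_approx measurableT mf ij; apply.
congr (limn _); apply/funext => k.
transitivity (\int[P0]_w (\sum_(y \in range (g k)) (y * (a w * \1_(g k @^-1` [set y]) (xi w)))%:E))%E.
  apply: eq_integral => w _.
  rewrite [in LHS]fimfunE -EFinM fsumEFin//=; congr EFin.
  rewrite [in LHS]mulrC mulr_fsuml//; apply: eq_fsbigr => y _.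
  by rewrite -mulrA; congr (_ * _); rewrite mulrC.
have mi y : measurable_fun setT (fun w => a w * \1_(g k @^-1` [set y]) (xi w)).
  by apply: measurable_funM => //; apply: measurableT_comp.
rewrite ge0_integral_fsum//.
- apply: eq_fsbigr => y /set_mem [u _ <-].
  under eq_integral do rewrite EFinM.
  rewrite ge0_integralZl//.
  + by apply/measurable_EFinP.
  + by move=> w _; rewrite lee_fin mulr_ge0.
  + by rewrite lee_fin.
- by move=> y; apply/measurable_EFinP; apply: measurable_funM => //.
- move=> y w _; rewrite lee_fin indicE.
  have [/set_mem/= <-|_] := boolP (_ \in _); last by rewrite !mulr0.
  by rewrite mulr1 mulr_ge0.
Qed.

(** Both sides are limits of the same combinations of weighted masses of sets. The weights let one
    lemma serve three ends: replacing a law by its density, splitting off an independent factor, and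
    passing from events to functions of [X s] in the martingale property. *)
Lemma eq_integral_weight d1 d2 (T1 : measurableType d1) (T2 : measurableType d2)
  (P1 : {measure set T1 -> \bar R}) (P2 : {measure set T2 -> \bar R})
  (a1 : T1 -> R) (a2 : T2 -> R) (xi1 : T1 -> T) (xi2 : T2 -> T) (f : T -> \bar R) :
  measurable_fun setT a1 -> (forall w, 0 <= a1 w) -> measurable_fun setT xi1 ->
  measurable_fun setT a2 -> (forall w, 0 <= a2 w) -> measurable_fun setT xi2 ->
  (forall B, measurable B -> \int[P1]_w (a1 w * \1_B (xi1 w))%:E =
                             \int[P2]_w (a2 w * \1_B (xi2 w))%:E)%E ->
  measurable_fun setT f -> (forall x, 0 <= f x)%E ->
  (\int[P1]_w ((a1 w)%:E * f (xi1 w)) = \int[P2]_w ((a2 w)%:E * f (xi2 w)))%E.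
Proof.
move=> ma1 a10 mxi1 ma2 a20 mxi2 H mf f0.
rewrite !(integral_weight_approx _ mf)//.
congr (limn _); apply/funext => k; apply: eq_fsbigr => y _.
by rewrite H.
Qed.

End transfer.

Lemma prodf_indic (R : realType) (I : Type) (T : I -> Type) (r : seq I) (P : pred I)
    (B : forall i, set (T i)) (x : forall i, T i) :
  \prod_(i <- r | P i) (\1_(B i) (x i) : R) = (\big[andb/true]_(i <- r | P i) (x i \in B i))%:R.
Proof.
elim: r => [|i r IH]; first by rewrite !big_nil.
rewrite !big_cons; case: ifP => // _; rewrite IH indicE.
by case: (x i \in B i) => /=; rewrite ?mul1r ?mul0r.
Qed.

Section independence.
Context d (Omega : measurableType d) (R : realType) (P : probability Omega R).
Variables (k : nat) (xi : nat -> Omega -> R) (mu : nat -> probability (measurableTypeR R) R).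
Hypothesis mxi : forall i, measurable_fun setT (xi i).
Hypothesis indep : forall A : nat -> set R,
  (forall i, (i < k)%N -> measurable (A i)) ->
  P (\bigcap_(i in [set i | (i < k)%N]) [set w | A i (xi i w)]) =
  (\big[*%E/1%E]_(i < k) mu i (A i))%E.

Lemma indep_expectation_prod (f : nat -> R -> R) (c : nat -> R) :
  (forall i, measurable_fun setT (f i)) -> (forall i x, 0 <= f i x) ->
  (forall i, (i < k)%N -> \int[mu i]_x (f i x)%:E = (c i)%:E)%E ->
  (\int[P]_w (\prod_(i < k) f i (xi i w))%:E = (\prod_(i < k) c i)%:E)%E.
Proof.
(* The factors are freed one at a time: the first [j] are arbitrary, the others indicators. For
   [j = 0] this is the hypothesis [indep]. *)
suff H j : (j <= k)%N -> forall (f : nat -> R -> R) (c : nat -> R),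
  (forall i, measurable_fun setT (f i)) -> (forall i x, 0 <= f i x) ->
  (forall i, (i < k)%N -> \int[mu i]_x (f i x)%:E = (c i)%:E)%E ->
  (forall i, (j <= i < k)%N -> exists2 B, measurable B & f i = \1_B) ->
  (\int[P]_w (\prod_(i < k) f i (xi i w))%:E = (\prod_(i < k) c i)%:E)%E.
  by move=> mf f0 fc; apply: (H k) => // i; rewrite ltnNge andbN.
elim: j => [_|j IH jk] {}f {}c mf f0 fc fB.
  have [B HB] : {B : nat -> set R & forall i, (i < k)%N -> measurable (B i) /\ f i = \1_(B i)}.
    apply: (@choice _ _ (fun i b => (i < k)%N -> measurable b /\ f i = \1_b)) => i.
    case: (ltnP i k) => ik; last by exists set0.
    by have [b mb fb] := fB i ik; exists b.
  transitivity (\int[P]_w (\1_(\bigcap_(i in [set i | (i < k)%N]) [set w | B i (xi i w)]) w)%:E)%E.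
    apply: eq_integral => w _; congr EFin.
    rewrite (eq_bigr (fun i : 'I_k => \1_(B i) (xi i w))); last first.
      by move=> i _; have [_ ->] := HB _ (ltn_ord i).
    rewrite (@prodf_indic R _ (fun=> R) _ _ (fun i : 'I_k => B i) (fun i => xi i w)) indicE; congr (_%:R); congr nat_of_bool.
    rewrite big_all_cond; apply/allP/idP => [h|/set_mem h i _].
      apply/mem_set => i /= ik; apply/set_mem.
      by apply: (h (Ordinal ik)); rewrite mem_index_enum.
    by rewrite /=; apply/mem_set; exact: (h i (ltn_ord i)).
  have mBi i : (i < k)%N -> measurable [set w | B i (xi i w)].
    by move=> ik; rewrite -[X in measurable X]setTI; apply: mxi => //; have [] := HB i ik.
  rewrite integral_indic ?setIT//; last first.
    by apply: bigcap_measurableType => i /= ik; exact: mBi.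
  apply: (etrans (indep _)); first by move=> i ik; have [] := HB i ik.
  transitivity (\big[*%E/1%E]_(i < k) (c i)%:E)%E.
    apply: eq_bigr => i _; rewrite -fc//; have [mB ->] := HB i (ltn_ord i).
    by rewrite integral_indic// setIT.
  by rewrite prodEFin.
pose a w := \prod_(i < k | i != j :> nat) f i (xi i w).
have ma : measurable_fun setT a.
  by apply: measurable_fun_prodr => i _; apply: measurableT_comp.
have a0 w : 0 <= a w by apply: prodr_ge0.
pose C := \prod_(i < k | i != j :> nat) c i.
have c0 i : (i < k)%N -> 0 <= c i.
  by move=> ik; rewrite -lee_fin -fc//; apply: integral_ge0 => x _; rewrite lee_fin.
have C0 : 0 <= C by apply: prodr_ge0 => i _; exact: c0.
have split (g : nat -> R) : \prod_(i < k) g i = (\prod_(i < k | i != j :> nat) g i) * g j.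
  by rewrite (bigD1 (Ordinal jk))//= mulrC.
transitivity (\int[P]_w ((a w)%:E * (f j (xi j w))%:E))%E.
  by apply: eq_integral => w _; rewrite (split (fun i => f i (xi i w))).
(* The other factors act as a weight, replaced by the constant [C] under [mu j]. Agreement on a set
   [B] is the induction hypothesis with [f j] replaced by the indicator of [B]. *)
rewrite (@eq_integral_weight _ _ _ _ _ _ _ P (mu j) a (fun=> C) (xi j) id (fun x => (f j x)%:E))//.
- rewrite ge0_integralZl//.
  + by rewrite fc// (split c).
  + apply/measurable_EFinP; exact: (mf j).
  + by move=> x _; rewrite lee_fin.
- move=> B mB.
  pose f' i := if i == j then \1_B : R -> R else f i.
  pose c' i := if i == j then fine (mu j B) else c i.
  transitivity (\int[P]_w (\prod_(i < k) f' i (xi i w))%:E)%E.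
    apply: eq_integral => w _; congr EFin.
    rewrite (split (fun i => f' i (xi i w))) /f' eqxx; congr (_ * _).
    by apply: eq_bigr => i /negbTE ->.
  rewrite (IH (ltnW jk) f' c').
  + rewrite (split c') /c' eqxx.
    under [RHS]eq_integral do rewrite EFinM.
    rewrite ge0_integralZl//; last first.
      by apply/measurable_EFinP; exact: measurable_indic.
    rewrite integral_indic// setIT EFinM fineK ?fin_num_measure//; congr (_ * _)%E.
    by congr EFin; apply: eq_bigr => i /negbTE ->.
  + by move=> i; rewrite /f'; case: ifP.
  + by move=> i x; rewrite /f'; case: ifP.
  + move=> i ik; rewrite /f' /c'; case: ifP => [/eqP ij|_]; last exact: fc.
    by rewrite integral_indic// setIT ij fineK// fin_num_measure.
  + move=> i /andP[ji ik]; rewrite /f'; case: eqP => [_|/eqP ij]; first by exists B.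
    by apply: fB; rewrite ik andbT ltn_neqAle eq_sym ij.
- exact/measurable_EFinP.
- by move=> x; rewrite lee_fin.
Qed.

End independence.

(** Completing the square turns the weight times the centred normal density into the normal density
    of mean [a * delta]. *)
Lemma integral_normal_prob_expR (R : realType) (a delta : R) : 0 < delta ->
  (\int[normal_prob 0 (Num.sqrt delta)]_x (expR (a * x - a ^+ 2 * delta / 2))%:E = 1)%E.
Proof.
move=> d0; have s0 : Num.sqrt delta != 0 by rewrite gt_eqF// sqrtr_gt0.
set s := Num.sqrt delta; pose f x := expR (a * x - a ^+ 2 * delta / 2).
have mf : measurable_fun setT f.
  by apply: measurableT_comp => //; apply: measurable_funB => //.
have mp m := measurable_normal_pdf m s.
transitivity (\int[normal_prob 0 s]_x ((cst 1 x)%:E * (f x)%:E))%E.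
  by apply: eq_integral => x _; rewrite mul1e.
rewrite (@eq_integral_weight _ _ R _ _ _ _ (normal_prob 0 s) lebesgue_measure
   (cst 1) (normal_pdf 0 s) id id (fun x => (f x)%:E))//.
- rewrite -[RHS](integral_normal_pdf (a * delta) s); apply: eq_integral => x _.
  rewrite -EFinM !normal_pdfE//; congr EFin; rewrite /f mulrAC -mulrA; congr (_ * _).
  rewrite /normal_fun -expRD; congr expR.
  have -> : s ^+ 2 = delta by rewrite sqr_sqrtr// ltW.
  by field; rewrite gt_eqF.
- exact: (mp 0).
- by move=> x; exact: normal_pdf_ge0.
- move=> B mB; under eq_integral do rewrite mul1r.
  rewrite integral_indic// setIT.
  transitivity (\int[lebesgue_measure]_(x in B) (normal_pdf 0 s x)%:E)%E; first by [].
  rewrite [LHS]integral_mkcond; apply: eq_integral => x _; rewrite patchE indicE.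
  by case: ifPn => _; rewrite ?mulr1 ?mulr0.
- exact/measurable_EFinP.
- by move=> x; rewrite lee_fin expR_ge0.
Qed.

Section uniform_integrability.
Context d (T : measurableType d) (R : realType) (P : probability T R).

(** The L^2 bound gives uniform integrability: in [f_k <= min(f_k, K) + f_k^2 / K] the truncated
    part passes to the limit by domination and the remainder costs at most [C / K]. Fatou's lemma
    gives the other inequality. *)
Lemma integral_cvg_bounded_sqr (f_ : nat -> T -> R) (f : T -> R) (a C : R) :
  (forall k, measurable_fun setT (f_ k)) -> (forall k w, 0 <= f_ k w) ->
  (forall w, f_ k w @[k --> \oo] --> f w) ->
  (forall k, \int[P]_w (f_ k w ^+ 2)%:E <= C%:E)%E ->
  (forall k, \int[P]_w (f_ k w)%:E = a%:E)%E ->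
  (\int[P]_w (f w)%:E = a%:E)%E.
Proof.
move=> mf_ f_0 f_f f2 fa.
have f0 w : 0 <= f w.
  by rewrite -(cvg_lim _ (f_f w))//; apply: limr_ge; [exact: cvgP (f_f w)|exact: nearW].
have mf : measurable_fun setT f by exact: (measurable_fun_cvg mf_ (fun w _ => f_f w)).
have C0 : 0 <= C.
  rewrite -lee_fin; apply: le_trans (f2 0%N); apply: integral_ge0 => w _.
  by rewrite lee_fin sqr_ge0.
have cvgE w : (f_ k w)%:E @[k --> \oo] --> (f w)%:E.
  by apply: cvg_EFin; [exact: nearW|exact: f_f].
apply/eqP; rewrite eq_le; apply/andP; split.
  have := @fatou _ _ _ P _ measurableT (fun k w => (f_ k w)%:E)
    (fun k => (measurable_EFinP _ _).2 (mf_ k)) (fun k w _ => f_0 k w).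
  under eq_integral => w _.
    rewrite (is_cvg_limn_einfE (cvgP _ (cvgE w))) (cvg_lim _ (cvgE w))//.
    over.
  move=> /le_trans; apply; under eq_fun do rewrite fa.
  by rewrite (is_cvg_limn_einfE (cvgP _ (cvg_cst a%:E))) lim_cst.
suff H K : 0 < K -> (a%:E <= \int[P]_w (f w)%:E + (C / K)%:E)%E.
  apply/lee_addgt0Pr => e e0.
  have K0 : 0 < C / e + 1 by rewrite ltr_wpDl// divr_ge0// ltW.
  apply: (le_trans (H _ K0)); rewrite leeD2l// lee_fin.
  rewrite ler_pdivrMr// mulrDr mulr1 mulrCA divff ?gt_eqF// mulr1.
  by rewrite lerDl ltW.
move=> K0.
pose g k w := minr (f_ k w) K.
have mg k : measurable_fun setT (g k) by apply: measurable_minr.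
have g0 k w : 0 <= g k w by rewrite le_min f_0 ltW.
have step k : (a%:E <= \int[P]_w (g k w)%:E + (C / K)%:E)%E.
  rewrite -(fa k).
  apply: (@le_trans _ _ (\int[P]_w ((g k w)%:E + (K^-1 * f_ k w ^+ 2)%:E))%E).
    apply: ge0_le_integral => //.
    - by move=> w _; rewrite lee_fin.
    - exact/measurable_EFinP.
    - apply: emeasurable_funD; apply/measurable_EFinP => //.
      by apply: measurable_funM => //; exact: measurable_funX.
    - move=> w _; rewrite -EFinD lee_fin /g /minr; case: ifPn => h.
        by rewrite lerDl mulr_ge0// ?sqr_ge0// invr_ge0 ltW.
      rewrite -leNgt in h; apply: ler_wpDl; first exact: ltW.
      rewrite ler_pdivlMl// expr2.
      by rewrite ler_wpM2r.
  rewrite ge0_integralD//.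
  - rewrite leeD2l//.
    under eq_integral do rewrite EFinM.
    rewrite ge0_integralZl//.
    + rewrite mulrC EFinM; apply: lee_wpmul2l => //.
      by rewrite lee_fin invr_ge0 ltW.
    + by apply/measurable_EFinP; exact: measurable_funX.
    + by move=> w _; rewrite lee_fin sqr_ge0.
    + by rewrite lee_fin invr_ge0 ltW.
  - by move=> w _; rewrite lee_fin.
  - exact/measurable_EFinP.
  - by move=> w _; rewrite lee_fin// mulr_ge0// ?sqr_ge0// invr_ge0 ltW.
  - by apply/measurable_EFinP; apply: measurable_funM => //; exact: measurable_funX.
have gcvg w : g k w @[k --> \oo] --> minr (f w) K.
  rewrite minr_absE; under eq_fun do rewrite /g minr_absE.
  apply: cvgMl; apply: cvgB; first by apply: cvgD; [exact: f_f|exact: cvg_cst].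
  by apply: cvg_norm; apply: cvgB; [exact: f_f|exact: cvg_cst].
have [_ _ dc] : [/\ P.-integrable setT (fun w => (minr (f w) K)%:E),
   [sequence \int[P]_w `|(g k w)%:E - (minr (f w) K)%:E|]_k @ \oo --> 0 &
   [sequence \int[P]_w (g k w)%:E]_k @ \oo --> \int[P]_w (minr (f w) K)%:E]%E.
  apply: (@dominated_convergence _ _ _ P _ measurableT _ _ (EFin \o cst K)).
  - by move=> k; apply/measurable_EFinP.
  - by apply/measurable_EFinP; apply: measurable_minr.
  - by apply: aeW => w _; apply: cvg_EFin; [exact: nearW|exact: gcvg].
  - exact: finite_measure_integrable_cst.
  - by apply: aeW => w k _; rewrite /= lee_fin ger0_norm// ge_min lexx orbT.
apply: (@le_trans _ _ (\int[P]_w (minr (f w) K)%:E + (C / K)%:E)%E); last first.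
  rewrite leeD2r//; apply: ge0_le_integral => //.
  - by move=> w _; rewrite lee_fin le_min f0 ltW.
  - by apply/measurable_EFinP; apply: measurable_minr.
  - exact/measurable_EFinP.
  - by move=> w _; rewrite lee_fin ge_min lexx.
rewrite -leeBlDr// -(cvg_lim _ dc)//; apply: lime_ge; first exact: cvgP dc.
by apply: nearW => k; rewrite leeBlDr//; exact: step.
Qed.
End uniform_integrability.

(** * Dyadic grids and Riemann sums *)

Section dyadic_grid.
Context {R : realType}.
Implicit Types (a b u : R) (N j : nat).

Definition grid a b N j := a + (b - a) * (j%:R / (2 ^ N)%:R).

Lemma pow2_gt0 N : 0 < (2 ^ N)%:R :> R.
Proof. by rewrite ltr0n expn_gt0. Qed.

Lemma grid0 a b N : grid a b N 0 = a.
Proof. by rewrite /grid mul0r mulr0 addr0. Qed.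

Lemma grid_last a b N : grid a b N (2 ^ N) = b.
Proof. by rewrite /grid divff ?gt_eqF ?pow2_gt0// mulr1 addrC subrK. Qed.

Lemma gridS a b N j : grid a b N j.+1 - grid a b N j = (b - a) / (2 ^ N)%:R.
Proof. by rewrite /grid -natr1; field; rewrite gt_eqF ?pow2_gt0. Qed.

Lemma grid_le a b N i j : a <= b -> (i <= j)%N -> grid a b N i <= grid a b N j.
Proof.
move=> ab ij; rewrite lerD2l ler_wpM2l ?subr_ge0//.
by rewrite ler_pM2r ?invr_gt0 ?pow2_gt0// ler_nat.
Qed.

Lemma grid_ltS a b N j : a < b -> grid a b N j < grid a b N j.+1.
Proof. by move=> ab; rewrite -subr_gt0 gridS divr_gt0 ?subr_gt0 ?pow2_gt0. Qed.

Lemma grid_itv a b N j : a <= b -> (j <= 2 ^ N)%N -> a <= grid a b N j <= b.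
Proof.
move=> ab jN; rewrite -{1}(grid0 a b N) -{4}(grid_last a b N).
by rewrite !grid_le.
Qed.

(** Dyadic subdivision of [[a, grid a b N j]] stays inside the finer grids of [[a, b]], so the
    Riemann sums for X at a grid time use increments of one nested family of grids. *)
Lemma grid_sub a b N M i j :
  grid a (grid a b N j) M i = grid a b (N + M) (j * i).
Proof.
rewrite /grid expnD !natrM; field.
by rewrite !gt_eqF ?pow2_gt0.
Qed.

Definition clip a b u := maxr a (minr u b).

Lemma clip_itv a b u : a <= b -> a <= clip a b u <= b.
Proof. by move=> ab; rewrite /clip le_max lexx/= ge_max ab ge_min lexx orbT. Qed.

Lemma clip_id a b u : a <= u <= b -> clip a b u = u.
Proof. by move=> /andP[au ub]; rewrite /clip min_l// max_r. Qed.

(** Only indices below [2 ^ N] are searched. A failed search returns [2 ^ N], so that every time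
    after the last but one grid point, even beyond [b], is rounded to [b]. Rounding goes upwards,
    which keeps a rounded stopping time a stopping time. *)
Definition gidx a b N u := find (fun i => u <= grid a b N i) (iota 0 (2 ^ N)).

Lemma gidx_le a b N u : (gidx a b N u <= 2 ^ N)%N.
Proof. by rewrite (leq_trans (find_size _ _))// size_iota. Qed.

Lemma gidxP a b N u i : a <= b -> (i < 2 ^ N)%N ->
  (gidx a b N u <= i)%N = (u <= grid a b N i).
Proof.
move=> ab iN; apply/idP/idP => [h|h].
  have hs : has (fun i => u <= grid a b N i) (iota 0 (2 ^ N)).
    by rewrite has_find size_iota (leq_ltn_trans h).
  have := nth_find 0%N hs; rewrite nth_iota; last first.
    by rewrite (leq_ltn_trans h).
  by rewrite add0n => /le_trans; apply; exact: grid_le.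
rewrite leqNgt; apply/negP => /(before_find 0%N).
by rewrite nth_iota// add0n h.
Qed.

Lemma grid_gidx a b N u : a <= b ->
  clip a b u <= grid a b N (gidx a b N u) <= clip a b u + (b - a) / (2 ^ N)%:R.
Proof.
move=> ab; have e0 : 0 <= (b - a) / (2 ^ N)%:R by rewrite divr_ge0 ?subr_ge0// ltW ?pow2_gt0.
have /andP[ac cb] := clip_itv u ab.
apply/andP; split.
  have := gidx_le a b N u; rewrite leq_eqVlt => /orP[/eqP->|lt].
    by rewrite grid_last.
  rewrite ge_max (andP (grid_itv ab (ltnW lt))).1/= ge_min -gidxP// leqnn//.
case E : (gidx a b N u) => [|i]; first by rewrite grid0 ler_wpDr.
rewrite -(gridS a b N i) -lerBlDr opprB addrC subrK.
have iN : (i < 2 ^ N)%N by rewrite -E gidx_le.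
have : ~~ (u <= grid a b N i) by rewrite -gidxP// E ltnn.
rewrite -ltNge => iu; rewrite le_max le_min (ltW iu) (andP (grid_itv ab (ltnW iN))).2.
by rewrite orbT.
Qed.

Lemma cvg_mesh (c : R) : c / (2 ^ N)%:R @[N --> \oo] --> 0.
Proof.
rewrite -(mulr0 c); apply: cvgMr.
have h : (2 : R)^-1 ^+ N @[N --> \oo] --> 0.
  by apply: cvg_expr; rewrite ger0_norm ?invr_ge0// invf_lt1// ltr1n.
by under eq_fun do rewrite natrX -exprVn.
Qed.

Lemma cvg_grid_gidx a b u : a <= b ->
  grid a b N (gidx a b N u) @[N --> \oo] --> clip a b u.
Proof.
move=> ab.
apply: (@squeeze_cvgr _ _ _ _ (fun=> clip a b u) (fun N => clip a b u + (b - a) / (2 ^ N)%:R)).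
- by apply: nearW => N; exact: grid_gidx.
- exact: cvg_cst.
- by rewrite -[X in _ --> X]addr0; apply: cvgD; [exact: cvg_cst|exact: cvg_mesh].
Qed.

End dyadic_grid.

Section riemann.
Context {R : realType}.

Lemma within_continuousP (f : R -> R) (A : set R) :
  {within A, continuous f} ->
  forall u, A u -> forall e : R, 0 < e -> exists2 r : R, 0 < r &
    forall v, A v -> `|u - v| < r -> `|f u - f v| < e.
Proof.
move=> /subspace_continuousP fc u Au e e0.
have /cvgrPdist_lt/(_ _ e0) := fc u Au.
move=> [r /= r0 H]; exists r => // v Av uv.
exact: (H v uv Av).
Qed.

Lemma segment_unif_continuous (f : R -> R) (a b : R) :
  {within `[a, b], continuous f} -> forall e : R, 0 < e -> exists2 r : R, 0 < r &
    forall u v, a <= u <= b -> a <= v <= b -> `|u - v| < r -> `|f u - f v| < e.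
Proof.
move=> fc e e0.
have e20 : 0 < e / 2 by rewrite divr_gt0.
have /compact_near_coveringP cpt := @segment_compact R a b.
pose Q (r : R) (u : R) := a <= u <= b -> forall v, a <= v <= b -> `|u - v| < r -> `|f u - f v| < e.
have := cpt R (0^'+) Q _; case.
- move=> u uab.
  have [r r0 H] := within_continuousP fc uab e20.
  have r20 : 0 < r / 2 by rewrite divr_gt0.
  exists (ball u (r / 2), [set s | 0 < s < r / 2]).
    split => /=; first exact: nbhsx_ballx.
    exists (r / 2) => //= s /=; rewrite sub0r normrN => h s0; rewrite s0/=.
    by rewrite (le_lt_trans (ler_norm _)).
  move=> [u' s]/= [] uu' /andP[s0 sr] u'ab v vab u'v.
  have u'r : `|u - u'| < r by rewrite (lt_trans uu')// gtr_pMr// invf_lt1// ltr1n.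
  have uvr : `|u - v| < r.
    rewrite (le_lt_trans (ler_distD u' _ _))// [ltRHS](splitr r) ltrD//.
    exact: lt_trans sr.
  rewrite (le_lt_trans (ler_distD (f u) _ _))// [ltRHS](splitr e) ltrD//.
    by rewrite distrC; apply: H => //=; rewrite in_itv.
  by apply: H => //=; rewrite in_itv.
- move=> r /= r0 H; exists (r / 2); first by rewrite divr_gt0.
  move=> u v uab vab uv; apply: (H (r / 2)) => //=.
  + by rewrite sub0r normrN gtr0_norm ?divr_gt0// gtr_pMr// invf_lt1// ltr1n.
  + by rewrite divr_gt0.
Qed.

Lemma ler_norm_sum_telescope (K : nat) (F V G : nat -> R) (e : R) :
  (forall j, (j < K)%N -> `|F j.+1 - F j - V j| <= e * (G j.+1 - G j)) ->
  `|F K - F 0%N - \sum_(j < K) V j| <= e * (G K - G 0%N).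
Proof.
move=> H; have tele (Q : nat -> R) : Q K - Q 0%N = \sum_(j < K) (Q j.+1 - Q j).
  by rewrite -(telescope_sumr Q (leq0n K)) big_mkord.
rewrite !tele -sumrB mulr_sumr (le_trans (ler_norm_sum _ _ _))//.
by apply: ler_sum => j _; exact: H.
Qed.

(* [X_s = (1 - s) Z_s] solves [dX = - Z ds + dW]; the hypothesis [XW] is that
   equation with the drift integral replaced by its right-endpoint estimate. *)
Lemma riemann_sum_cvg (Z W : R -> R) (a b : R) : a <= b -> b < 1 ->
  {within `[a, b], continuous Z} ->
  (forall u v e, a <= u -> u <= v -> v <= b ->
    (forall r, u <= r <= v -> `|Z r - Z v| <= e) ->
    `|(1 - v) * Z v - (1 - u) * Z u + (v - u) * Z v - (W v - W u)| <= e * (v - u)) ->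
  \sum_(j < 2 ^ N) (1 - grid a b N j)^-1 * (W (grid a b N j.+1) - W (grid a b N j))
    @[N --> \oo] --> Z b - Z a.
Proof.
move=> ab b1 Zc XW.
apply/cvgrPdist_le => e e0.
have b10 : 0 < 1 - b by rewrite subr_gt0.
(* The factor [1 - b] pays for [(1 - u)^-1 <= (1 - b)^-1]; the [+ 1] keeps the denominator positive
   when [a = b]. *)
pose e' := e * (1 - b) / (b - a + 1).
have e'0 : 0 < e' by rewrite divr_gt0 ?mulr_gt0// ltr_wpDl// subr_ge0.
have [r r0 Hr] := segment_unif_continuous Zc e'0.
have /cvgrPdist_lt/(_ _ r0) := @cvg_mesh R (b - a).
apply: filterS => N; rewrite sub0r normrN ger0_norm; last first.
  by rewrite divr_ge0 ?subr_ge0// ltW// pow2_gt0.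
move=> mesh.
have := @ler_norm_sum_telescope (2 ^ N) (fun j => Z (grid a b N j))
  (fun j => (1 - grid a b N j)^-1 * (W (grid a b N j.+1) - W (grid a b N j)))
  (grid a b N) (e' / (1 - b)).
rewrite !grid_last !grid0 => /(_ _)/le_trans; apply; last first.
  have ba1 : 0 < b - a + 1 by rewrite ltr_wpDl// subr_ge0.
  have -> : e' / (1 - b) * (b - a) = e * ((b - a) / (b - a + 1)).
    by rewrite /e'; field; rewrite !gt_eqF.
  by rewrite ler_piMr ?(ltW e0)// ler_pdivrMr// mul1r lerDl.
move=> j jN; set u := grid a b N j; set v := grid a b N j.+1.
have /andP[au _] := grid_itv ab (ltnW jN).
have /andP[_ vb] := grid_itv ab jN.
have uv : u <= v by apply: grid_le.
have u1 : 0 < 1 - u by rewrite subr_gt0 (le_lt_trans uv)// (le_lt_trans vb).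
(* As [(1 - v) + (v - u) = 1 - u], the error on one cell is [(1 - u)^-1] times the residual bounded
   by [XW]. This is why the drift is estimated at the right endpoint. *)
have -> : Z v - Z u - (1 - u)^-1 * (W v - W u) =
  (1 - u)^-1 * ((1 - v) * Z v - (1 - u) * Z u + (v - u) * Z v - (W v - W u)).
  by field; rewrite gt_eqF.
rewrite normrM gtr0_norm ?invr_gt0//.
apply: (@le_trans _ _ ((1 - u)^-1 * (e' * (v - u)))).
  rewrite ler_wpM2l ?invr_ge0 ?(ltW u1)//; apply: XW => // s /andP[us sv].
  apply/ltW/Hr.
  - by rewrite (le_trans au us) (le_trans sv vb).
  - by rewrite (le_trans au uv) vb.
  - rewrite distrC ger0_norm ?subr_ge0//; apply: le_lt_trans mesh.
    by rewrite -(gridS a b N j) lerB.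
rewrite mulrCA mulrA ler_wpM2r ?subr_ge0// ler_wpM2l ?(ltW e'0)//.
by rewrite lef_pV2 ?posrE// lerD2l lerN2 (le_trans uv).
Qed.

(** These are left Riemann sums of [ds / (1 - s)^2], the quadratic variation of Z. The error on a
    cell [[u, v]] is exactly [(1 - u)^-2 (1 - v)^-1 (v - u)^2], whence the constant [(1 - b)^-3]. *)
Lemma riemann_sum_sqr_cvg (a b : R) : a <= b -> b < 1 ->
  \sum_(j < 2 ^ N) (1 - grid a b N j)^-1 ^+ 2 * (grid a b N j.+1 - grid a b N j)
    @[N --> \oo] --> (1 - b)^-1 - (1 - a)^-1.
Proof.
move=> ab b1; apply/cvgrPdist_le => e e0.
have b10 : 0 < 1 - b by rewrite subr_gt0.
pose C := (1 - b)^-1 ^+ 3.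
have C0 : 0 < C by rewrite exprn_gt0// invr_gt0.
have /cvgrPdist_le/(_ _ e0) := @cvg_mesh R (C * (b - a) * (b - a)).
apply: filterS => N; rewrite sub0r normrN ger0_norm; last first.
  have ba0 : 0 <= b - a by rewrite subr_ge0.
  by rewrite divr_ge0// mulr_ge0// mulr_ge0// ltW.
move=> mesh.
have := @ler_norm_sum_telescope (2 ^ N) (fun j => (1 - grid a b N j)^-1)
  (fun j => (1 - grid a b N j)^-1 ^+ 2 * (grid a b N j.+1 - grid a b N j))
  (grid a b N) (C * ((b - a) / (2 ^ N)%:R)).
rewrite !grid_last !grid0 => /(_ _)/le_trans; apply; last first.
  by rewrite (le_trans _ mesh)// le_eqVlt; apply/orP; left; apply/eqP; ring.
move=> j jN; rewrite -(gridS a b N j).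
set u := grid a b N j; set v := grid a b N j.+1.
have /andP[au _] := grid_itv ab (ltnW jN).
have /andP[_ vb] := grid_itv ab jN.
have uv : u <= v by apply: grid_le.
have v1 : 0 < 1 - v by rewrite subr_gt0 (le_lt_trans vb).
have u1 : 0 < 1 - u by rewrite subr_gt0 (le_lt_trans uv)// (le_lt_trans vb).
have -> : (1 - v)^-1 - (1 - u)^-1 - (1 - u)^-1 ^+ 2 * (v - u) =
  (1 - u)^-1 ^+ 2 * (1 - v)^-1 * (v - u) * (v - u).
  by field; rewrite !gt_eqF.
have uv0 : 0 <= v - u by rewrite subr_ge0.
rewrite ger0_norm ?mulr_ge0 ?invr_ge0 ?(ltW v1) ?(ltW u1) ?sqr_ge0//.
rewrite ler_wpM2r// ler_wpM2r//.
have iu : (1 - u)^-1 <= (1 - b)^-1.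
  by rewrite lef_pV2 ?posrE// lerD2l lerN2 (le_trans uv).
have iv : (1 - v)^-1 <= (1 - b)^-1 by rewrite lef_pV2 ?posrE// lerD2l lerN2.
rewrite /C (exprSr _ 2) ler_pM ?sqr_ge0 ?invr_ge0 ?(ltW v1)//.
by rewrite ler_pXn2r ?nnegrE ?invr_ge0 ?(ltW u1) ?(ltW b10).
Qed.

End riemann.

(** * Exponential martingales of the bridge *)

Section bridge.
Context {R : realType}.

Lemma Rintegral_right_endpoint (f : R -> R) (u v e : R) : u <= v ->
  {within `[u, v], continuous f} ->
  (forall r, u <= r <= v -> `|f r - f v| <= e) ->
  `|\int[lebesgue_measure]_(r in `]u, v]) f r - (v - u) * f v| <= e * (v - u).
Proof.
move=> uv fc fe.
have sub (g : R -> R) : {within `[u, v], continuous g} ->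
    lebesgue_measure.-integrable `]u, v] (EFin \o g).
  move=> gc; have : lebesgue_measure.-integrable `[u, v] (EFin \o g).
    by apply: continuous_compact_integrable => //; exact: segment_compact.
  apply: integrableS => //; apply: subset_itvr; rewrite bnd_simp//.
have fi := sub f fc.
have ci (c : R) : lebesgue_measure.-integrable `]u, v] (EFin \o cst c).
  by apply: sub => ?; exact: cvg_cst.
have cE (c : R) : \int[lebesgue_measure]_(r in `]u, v]) c = c * (v - u).
  rewrite Rintegral_cst//= lebesgue_measure_itv/= lte_fin.
  move: uv; rewrite le_eqVlt => /predU1P[->|->//].
  by rewrite ltxx subrr.
have le1 : (f v - e) * (v - u) <= \int[lebesgue_measure]_(r in `]u, v]) f r.
  rewrite -cE; apply: le_Rintegral; [by []|by first [exact: ci|exact: fi]..|move=> r /=].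
  rewrite in_itv/= => /andP[ur rv].
  have := fe r; rewrite (ltW ur) rv => /(_ isT); rewrite ler_norml => /andP[+ _].
  by rewrite lerBrDl.
have le2 : \int[lebesgue_measure]_(r in `]u, v]) f r <= (f v + e) * (v - u).
  rewrite -cE; apply: le_Rintegral; [by []|by first [exact: ci|exact: fi]..|move=> r /=].
  rewrite in_itv/= => /andP[ur rv].
  have := fe r; rewrite (ltW ur) rv => /(_ isT); rewrite ler_norml => /andP[_].
  by rewrite lerBlDl.
rewrite ler_norml lerBrDr lerBlDr; apply/andP; split.
  by rewrite (le_trans _ le1)// le_eqVlt; apply/orP; left; apply/eqP; ring.
by rewrite (le_trans le2)// le_eqVlt; apply/orP; left; apply/eqP; ring.
Qed.

Context {d : measure_display} {Omega : measurableType d}.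
Variables (P : probability Omega R) (W : R -> Omega -> R) (hW : is_std_BM P W).
Variables (t x : R) (ht0 : 0 <= t) (ht1 : t < 1).
Variables (X : R -> Omega -> R) (hX : is_bridge W t x X).

Local Notation Z := (fun s w => X s w / (1 - s)).

Lemma bridge_start w : X t w = x.
Proof. by have [] := hX w. Qed.

Lemma bridge_continuous a b w : t <= a -> b < 1 ->
  {within `[a, b], continuous (fun s => X s w)}.
Proof.
move=> ta b1; have [_ [+ _]] := hX w; apply: continuous_subspaceW.
by apply: subset_itv; rewrite bnd_simp.
Qed.

Lemma bridge_ratio_continuous a b w : t <= a -> b < 1 ->
  {within `[a, b], continuous (fun s => Z s w)}.
Proof.
move=> ta b1; apply/subspace_continuousP => s sab.
have s1 : 1 - s != 0.
  by move: sab => /=; rewrite in_itv/= subr_eq0 => /andP[_ sb]; rewrite gt_eqF// (le_lt_trans sb).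
apply: cvgM.
  by move/subspace_continuousP : (@bridge_continuous a b w ta b1); exact.
apply: cvgV => //; apply: cvgB; first exact: cvg_cst.
by apply: cvg_within_filter; exact: cvg_id.
Qed.

Lemma bridge_drift u v (e : R) w : t <= u -> u <= v -> v < 1 ->
  (forall r, u <= r <= v -> `|Z r w - Z v w| <= e) ->
  `|(1 - v) * Z v w - (1 - u) * Z u w + (v - u) * Z v w - (W v w - W u w)| <= e * (v - u).
Proof.
move=> tu uv v1 Ze.
have [_ [_ eqX]] := hX w.
have u1 : u < 1 by exact: le_lt_trans v1.
have v0 : 1 - v != 0 by rewrite gt_eqF// subr_gt0.
have u0 : 1 - u != 0 by rewrite gt_eqF// subr_gt0.
have Xv : (1 - v) * Z v w = X v w by field.
have Xu : (1 - u) * Z u w = X u w by field.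
have := @Rintegral_right_endpoint (fun s => Z s w) u v e uv _ Ze.
have -> : \int[lebesgue_measure]_(r in `]u, v]) (Z r w) =
   - (X v w - X u w) + (W v w - W u w).
  rewrite -(@Rintegral_itvB R (fun s => Z s w) (BLeft t) (BRight v) u) ?bnd_simp//; last first.
    apply: continuous_compact_integrable; first exact: segment_compact.
    exact: bridge_ratio_continuous.
  rewrite (eqX v) ?(eqX u) ?tu ?(le_trans tu)//.
  ring.
rewrite -normrN Xv Xu => /(_ _)/(le_trans _); apply; last exact: bridge_ratio_continuous.
by rewrite le_eqVlt; apply/orP; left; apply/eqP; congr `|_|; ring.
Qed.

Lemma bridge_riemann a b w : t <= a -> a <= b -> b < 1 ->
  \sum_(j < 2 ^ N) (1 - grid a b N j)^-1 * (W (grid a b N j.+1) w - W (grid a b N j) w)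
    @[N --> \oo] --> Z b w - Z a w.
Proof.
move=> ta ab b1.
apply: (@riemann_sum_cvg _ (fun s => Z s w) (fun s => W s w)) => //.
  exact: bridge_ratio_continuous.
move=> u v e au uv vb Ze; apply: bridge_drift => //.
  exact: le_trans au.
exact: le_lt_trans b1.
Qed.

(** [phi] will be the identity, with the ambient sigma-algebra on its source or with the smaller one
    generated by the past. Only increments from time [t] on are asked to be measurable, since that
    past knows nothing else of W. *)
Lemma bridge_ratio_measurable d' (T : measurableType d') (phi : T -> Omega) b :
  (forall N j, (j <= 2 ^ N)%N ->
    measurable_fun setT (fun w => W (grid t b N j) (phi w) - W t (phi w))) ->
  t <= b -> b < 1 -> measurable_fun setT (fun w => Z b (phi w)).
Proof.
move=> mW tb b1.
have -> : (fun w => Z b (phi w)) =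
    (fun w => (Z b (phi w) - Z t (phi w)) + x / (1 - t)).
  by apply/funext => w; rewrite bridge_start subrK.
apply: measurable_funD => //.
have mS N : measurable_fun setT (fun w => \sum_(j < 2 ^ N)
    (1 - grid t b N j)^-1 * (W (grid t b N j.+1) (phi w) - W (grid t b N j) (phi w))).
  apply: measurable_fun_sumr => j _; apply: measurable_funM => //.
  have -> : (fun w => W (grid t b N j.+1) (phi w) - W (grid t b N j) (phi w)) =
      (fun w => (W (grid t b N j.+1) (phi w) - W t (phi w)) - (W (grid t b N j) (phi w) - W t (phi w))).
    by apply/funext => w; ring.
  by apply: measurable_funB; apply: mW => //; exact: ltnW.
exact: (measurable_fun_cvg mS (fun w _ => @bridge_riemann t b (phi w) (lexx t) tb b1)).
Qed.

Lemma bridge_measurable b : t <= b -> b < 1 -> measurable_fun setT (X b).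
Proof.
move=> tb b1; have [mW _ _ _] := hW.
have b0 : 1 - b != 0 by rewrite gt_eqF// subr_gt0.
have -> : X b = (fun w => (1 - b) * Z b w) by apply/funext => w; field.
apply: measurable_funM => //.
apply: (@bridge_ratio_measurable _ _ id) => // N j _.
exact: measurable_funB.
Qed.

End bridge.

(** A pi-lambda argument, in which the total weight one handles complements. It says that the weight
    has conditional expectation one given [<<s G >>]. *)
Lemma dynkin_weight d (Omega : measurableType d) (R : realType)
    (P : probability Omega R) (f : Omega -> R) (G : set (set Omega)) :
  measurable_fun setT f -> (forall w, 0 <= f w) ->
  (\int[P]_w (f w)%:E = 1)%E -> setI_closed G ->
  (forall A, G A -> measurable A /\ \int[P]_(w in A) (f w)%:E = P A)%E ->
  forall A, <<s G >> A -> (measurable A /\ \int[P]_(w in A) (f w)%:E = P A)%E.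
Proof.
move=> mf f0 f1 GI HG; pose D := [set A : set Omega | measurable A /\
  (\int[P]_(w in A) (f w)%:E = P A)%E].
suff H : <<s G >> `<=` D by move=> A /H.
have mfE (A : set Omega) : measurable_fun A (fun w => (f w)%:E).
  by apply: measurable_funTS; exact/measurable_EFinP.
apply: lambda_system_subset => //.
apply/dynkin_lambda_system; split.
- by split => //; rewrite f1 probability_setT.
- move=> A [mA fA]; split; first exact: measurableC.
  have : (\int[P]_(w in setT) (f w)%:E = P A + \int[P]_(w in ~` A) (f w)%:E)%E.
    rewrite -(setUv A) ge0_integral_setU//; first by rewrite fA.
    + exact: measurableC.
    + by move=> w _; rewrite lee_fin.
    + by rewrite disj_set2E setICr eqxx.
  rewrite f1 probability_setC// => ->.
  by rewrite addeAC subee ?add0e// fin_num_measure.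
- move=> F tF FD; have mF i : measurable (F i) by have [] := FD i.
  split; first exact: bigcup_measurable.
  rewrite ge0_integral_bigcup//; last by move=> w _; rewrite lee_fin.
  rewrite measure_bigcup//; under [RHS]eq_eseriesl do rewrite in_setT.
  apply: eq_eseriesr => i _.
  by have [] := FD i.
Qed.

(** * Discrete exponential martingales along finite time paths *)

Section brownian_increments.
Context {R : realType} {d : measure_display} {Omega : measurableType d}.
Variables (P : probability Omega R) (W : R -> Omega -> R) (hW : is_std_BM P W).

Definition incr (p : nat -> R) (i : nat) (w : Omega) := W (p i.+1) w - W (p i) w.

Definition cylinder (p : nat -> R) (k : nat) : set (set Omega) :=
  [set A | exists B : nat -> set R, (forall i, measurable (B i)) /\
     A = \bigcap_(i in [set i | (i < k)%N]) [set w | B i (incr p i w)]].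

Lemma measurable_incr p i : measurable_fun setT (incr p i).
Proof. by have [mW _ _ _] := hW; exact: measurable_funB. Qed.

Lemma cylinder_setI_closed p k : setI_closed (cylinder p k).
Proof.
move=> _ _ [B [mB ->]] [B' [mB' ->]]; exists (fun i => B i `&` B' i); split.
  by move=> i; exact: measurableI.
by rewrite -bigcapI.
Qed.

Lemma measurable_cylinder p k A : cylinder p k A -> measurable A.
Proof.
move=> [B [mB ->]]; apply: bigcap_measurableType => i _.
by rewrite -[X in measurable X]setTI; apply: measurable_incr.
Qed.

Lemma incr_measurable_cylinder p k i : (i < k)%N ->
  measurable_fun setT (incr p i : g_sigma_algebraType (cylinder p k) -> R).
Proof.
move=> ik _ B mB; rewrite setTI; apply: sub_sigma_algebra.
exists (fun j => if j == i then B else setT); split.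
  by move=> j; case: ifP.
apply/seteqP; split => [w /= Bw j /= jk|w /= /(_ i ik)]; last by rewrite eqxx.
by case: ifPn => // /eqP ->.
Qed.

(** A product of [kf] Gaussian factors of mean one, carried by the increments that follow the first
    [kp], which form the past. With [c i = lam / (1 - p i)] it is a discretisation of the
    exponential martingale of Z. *)
Definition exp_weight (c p : nat -> R) (kp kf : nat) (w : Omega) : R :=
  \prod_(i < kf) expR (c (kp + i)%N * incr p (kp + i)%N w
    - c (kp + i)%N ^+ 2 * (p (kp + i)%N.+1 - p (kp + i)%N) / 2).

Lemma measurable_exp_weight c p kp kf : measurable_fun setT (exp_weight c p kp kf).
Proof.
apply: measurable_fun_prodr => i _; apply: measurableT_comp => //.
by apply: measurable_funB => //; apply: measurable_funM => //; exact: measurable_incr.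
Qed.

Lemma exp_weight_ge0 c p kp kf w : 0 <= exp_weight c p kp kf w.
Proof. by apply: prodr_ge0 => i _; exact: expR_ge0. Qed.

(** The product formula for independent increments is applied to a mixed family: indicators on the
    [kp] past increments, exponentials of mean one on the [kf] later ones. *)
Lemma integral_exp_weight_cylinder c p kp kf : 0 <= p 0%N ->
  (forall i, (i < kp + kf)%N -> p i < p i.+1) ->
  forall A, cylinder p kp A -> (\int[P]_(w in A) (exp_weight c p kp kf w)%:E = P A)%E.
Proof.
move=> p0 pS A cA; have mA := measurable_cylinder cA.
move: cA => [B [mB AE]]; have [_ _ _ indep] := hW.
pose mu i : probability (measurableTypeR R) R := normal_prob 0 (Num.sqrt (p i.+1 - p i)).
pose F i := if (i < kp)%N then \1_(B i) : R -> R
  else fun y => expR (c i * y - c i ^+ 2 * (p i.+1 - p i) / 2).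
pose C i := if (i < kp)%N then fine (mu i (B i)) else 1.
have mF i : measurable_fun setT (F i).
  rewrite /F; case: ifP => // _.
  by apply: measurableT_comp => //; apply: measurable_funB.
have F0 i y : 0 <= F i y by rewrite /F; case: ifP => // _; exact: expR_ge0.
have FC i : (i < kp + kf)%N -> (\int[mu i]_y (F i y)%:E = (C i)%:E)%E.
  move=> ik; rewrite /F /C; case: ifP => _.
    rewrite integral_indic//; last exact: mB.
    by rewrite setIT fineK//; apply: fin_num_measure; exact: mB.
  by apply: integral_normal_prob_expR; rewrite subr_gt0 pS.
have indk k' : (k' <= kp + kf)%N -> forall A : nat -> set R,
    (forall i, (i < k')%N -> measurable (A i)) ->
  P (\bigcap_(i in [set i | (i < k')%N]) [set w | A i (incr p i w)]) =
  (\big[*%E/1%E]_(i < k') mu i (A i))%E.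
  by move=> kk' A' mA'; apply: indep => // i ik; apply: pS; exact: leq_trans kk'.
have H := indep_expectation_prod (measurable_incr p) (indk _ (leqnn _)) mF F0 FC.
have CE : \prod_(i < kp + kf) C i = \prod_(i < kp) fine (mu i (B i)).
  rewrite big_split_ord/= [X in _ * X]big1 ?mulr1.
    by apply: eq_bigr => i _; rewrite /C ltn_ord.
  by move=> i _; rewrite /C ltnNge leq_addr.
transitivity (\prod_(i < kp) fine (mu i (B i)))%:E.
  rewrite -CE -H integral_mkcond; apply: eq_integral => w _; rewrite patchE big_split_ord/=.
  have -> : \prod_(i < kp) F i (incr p i w) = (w \in A)%:R.
    rewrite (eq_bigr (fun i : 'I_kp => \1_(B i) (incr p i w))); last first.
      by move=> i _; rewrite /F ltn_ord.
    rewrite (@prodf_indic R _ (fun=> R) _ _ (fun i : 'I_kp => B i) (fun i => incr p i w)).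
    congr (_%:R); congr nat_of_bool; rewrite big_all_cond AE; apply/allP/idP => [h|/set_mem h i _].
      apply/mem_set => i /= ik; apply/set_mem.
      by apply: (h (Ordinal ik)); rewrite mem_index_enum.
    by rewrite /=; apply/mem_set; exact: (h i (ltn_ord i)).
  case: (w \in A); last by rewrite mul0r.
  rewrite mul1r; congr EFin; apply: eq_bigr => i _.
  by rewrite /F ltnNge leq_addr.
rewrite AE (indk kp)// ?leq_addr// -prodEFin; apply: eq_bigr => i _.
by rewrite fineK//; apply: fin_num_measure; exact: mB.
Qed.

Lemma integral_exp_weight c p kp kf : 0 <= p 0%N ->
  (forall i, (i < kp + kf)%N -> p i < p i.+1) ->
  (\int[P]_w (exp_weight c p kp kf w)%:E = 1)%E.
Proof.
move=> p0 pS; rewrite (integral_exp_weight_cylinder c p0 pS) ?probability_setT//.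
by exists (fun=> setT); split => //; apply/esym/seteqP; split.
Qed.

Lemma integral_exp_weight_past c p kp kf : 0 <= p 0%N ->
  (forall i, (i < kp + kf)%N -> p i < p i.+1) ->
  forall A, <<s cylinder p kp >> A ->
    (measurable A /\ \int[P]_(w in A) (exp_weight c p kp kf w)%:E = P A)%E.
Proof.
move=> p0 pS; apply: dynkin_weight.
- exact: measurable_exp_weight.
- exact: exp_weight_ge0.
- exact: integral_exp_weight.
- exact: cylinder_setI_closed.
- move=> A cA; split; first exact: measurable_cylinder cA.
  exact: integral_exp_weight_cylinder.
Qed.

End brownian_increments.

Section bridge_martingale.
Context {R : realType} {d : measure_display} {Omega : measurableType d}.
Variables (P : probability Omega R) (W : R -> Omega -> R) (hW : is_std_BM P W).
Variables (t x : R) (ht0 : 0 <= t) (ht1 : t < 1).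
Variables (X : R -> Omega -> R) (hX : is_bridge W t x X).

(** The ratio between times [b] and [a] of the exponential martingale of [Z = X / (1 - s)], whose
    quadratic variation over [[a, b]] is [(1 - b)^-1 - (1 - a)^-1]. *)
Definition expm (lam a b : R) (w : Omega) : R :=
  expR (lam * (X b w / (1 - b) - X a w / (1 - a))
        - lam ^+ 2 / 2 * ((1 - b)^-1 - (1 - a)^-1)).

Lemma measurable_expm lam a b : t <= a -> a < 1 -> t <= b -> b < 1 ->
  measurable_fun setT (expm lam a b).
Proof.
move=> ta a1 tb b1; apply: measurableT_comp => //; apply: measurable_funB => //.
apply: measurable_funM => //.
by apply: measurable_funB; apply: measurable_funM => //; exact: (bridge_measurable hW hX).
Qed.

(** The first [k] steps, which describe the past, stay fixed while the grid on [[s, T]] is refined;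
    the past cylinders then do not depend on [M]. *)
Definition join_path (p : nat -> R) (k : nat) (s T : R) (M i : nat) :=
  if (i <= k)%N then p i else grid s T M (i - k).

Lemma join_path_ge p k s T M j : p k = s -> join_path p k s T M (k + j) = grid s T M j.
Proof.
move=> pk; rewrite /join_path; case: j => [|j]; first by rewrite addn0 leqnn pk grid0.
by rewrite leqNgt addnS ltnS leq_addr/= -addnS addKn.
Qed.

Lemma join_path_inc p k s T M i : p k = s -> s < T ->
  (forall i, (i < k)%N -> p i < p i.+1) -> join_path p k s T M i < join_path p k s T M i.+1.
Proof.
move=> pk sT pS; have [ik|ki] := ltnP i k.
  by rewrite /join_path (ltnW ik) ik pS.
by rewrite -(subnKC ki) -addnS !join_path_ge// grid_ltS.
Qed.

Lemma cylinder_join_path p k s T M :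
  cylinder W (join_path p k s T M) k = cylinder W p k.
Proof.
have E B : \bigcap_(i in [set i | (i < k)%N]) [set w | B i (incr W (join_path p k s T M) i w)] =
    \bigcap_(i in [set i | (i < k)%N]) [set w | B i (incr W p i w)].
  by apply: eq_bigcapr => i /= ik; rewrite /incr /join_path ik (ltnW ik).
apply/seteqP; split => _ [B [mB ->]]; exists B; split => //.
Qed.

Lemma exp_weight_join_path lam p k s T M w : p k = s ->
  exp_weight W (fun i => lam / (1 - join_path p k s T M i)) (join_path p k s T M) k (2 ^ M) w =
  expR (lam * (\sum_(j < 2 ^ M) (1 - grid s T M j)^-1 *
          (W (grid s T M j.+1) w - W (grid s T M j) w))
        - lam ^+ 2 / 2 * \sum_(j < 2 ^ M) (1 - grid s T M j)^-1 ^+ 2 *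
          (grid s T M j.+1 - grid s T M j)).
Proof.
move=> pk; rewrite /exp_weight -expR_sum; congr expR.
rewrite !mulr_sumr -sumrB; apply: eq_bigr => j _.
by rewrite /incr -addnS !join_path_ge//; set y := (1 - _)^-1; field.
Qed.

(** Left sums of an increasing integrand lie below the integral for every mesh. The limit alone
    would not give an L^2 bound uniform in [M]. *)
Lemma riemann_sum_sqr_le (s T : R) M : s <= T -> T < 1 ->
  \sum_(j < 2 ^ M) (1 - grid s T M j)^-1 ^+ 2 * (grid s T M j.+1 - grid s T M j)
    <= (1 - T)^-1 - (1 - s)^-1.
Proof.
move=> sT T1.
rewrite -[in leRHS](grid_last s T M) -[in X in _ - X](grid0 s T M).
have -> : (1 - grid s T M (2 ^ M))^-1 - (1 - grid s T M 0)^-1 =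
    \sum_(j < 2 ^ M) ((1 - grid s T M j.+1)^-1 - (1 - grid s T M j)^-1).
  by rewrite -(telescope_sumr (fun j => (1 - grid s T M j)^-1) (leq0n _)) big_mkord.
apply: ler_sum => -[j jM] _ /=.
set u := grid s T M j; set v := grid s T M j.+1.
have /andP[su _] := grid_itv sT (ltnW jM).
have /andP[_ vT] := grid_itv sT jM.
have uv : u <= v by apply: grid_le.
have v1 : 0 < 1 - v by rewrite subr_gt0 (le_lt_trans vT).
have u1 : 0 < 1 - u by rewrite subr_gt0 (le_lt_trans uv)// (le_lt_trans vT).
have -> : (1 - v)^-1 - (1 - u)^-1 = (1 - u)^-1 * (1 - v)^-1 * (v - u).
  by field; rewrite !gt_eqF.
rewrite ler_wpM2r ?subr_ge0// expr2 ler_wpM2l ?invr_ge0 ?(ltW u1)//.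
by rewrite lef_pV2 ?posrE// lerD2l lerN2.
Qed.

Lemma integral_expm_cylinder lam (p : nat -> R) k s T : 0 <= p 0%N ->
  (forall i, (i < k)%N -> p i < p i.+1) -> p k = s -> t <= s -> s < T -> T < 1 ->
  forall A, <<s cylinder W p k >> A ->
    (measurable A /\ \int[P]_(w in A) (expm lam s T w)%:E = P A)%E.
Proof.
move=> p0 pS pk ts sT T1 A cA.
pose S M := \sum_(j < 2 ^ M) (1 - grid s T M j)^-1 ^+ 2 * (grid s T M j.+1 - grid s T M j).
pose D M w := \sum_(j < 2 ^ M) (1 - grid s T M j)^-1 * (W (grid s T M j.+1) w - W (grid s T M j) w).
pose f la M w := expR (la * D M w - la ^+ 2 / 2 * S M).
have fE la M : f la M = exp_weight W (fun i => la / (1 - join_path p k s T M i))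
    (join_path p k s T M) k (2 ^ M).
  by apply/funext => w; rewrite exp_weight_join_path.
have q0 M : 0 <= join_path p k s T M 0 by rewrite /join_path leq0n.
have qS M i : (i < k + 2 ^ M)%N -> join_path p k s T M i < join_path p k s T M i.+1.
  by move=> _; exact: join_path_inc.
have past la M : (measurable A /\ \int[P]_(w in A) (f la M w)%:E = P A)%E.
  rewrite fE; apply: (integral_exp_weight_past hW) => //; first exact: qS.
  by rewrite cylinder_join_path.
have [mA _] := past lam 0%N; split => //.
have f1 la M : (\int[P]_w (f la M w)%:E = 1)%E.
  by rewrite fE; apply: (integral_exp_weight hW) => //; exact: qS.
have mf la M : measurable_fun setT (f la M).
  by rewrite fE; exact: (measurable_exp_weight hW).
have i1E (g : Omega -> R) : (\int[P]_(w in A) (g w)%:E = \int[P]_w (\1_A w * g w)%:E)%E.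
  rewrite integral_mkcond; apply: eq_integral => w _; rewrite patchE indicE.
  by case: ifPn => _; rewrite ?mul1r ?mul0r.
rewrite i1E -(@fineK _ (P A)) ?fin_num_measure//.
apply: (@integral_cvg_bounded_sqr _ _ _ _ (fun M w => \1_A w * f lam M w) _ _
   (expR (lam ^+ 2 * ((1 - T)^-1 - (1 - s)^-1)))).
- by move=> M; apply: measurable_funM.
- by move=> M w; rewrite mulr_ge0// expR_ge0.
- move=> w; apply: cvgMr; apply: continuous_cvg; first exact: continuous_expR.
  apply: cvgB; apply: cvgMr.
    exact: (bridge_riemann hX ts (ltW sT) T1).
  exact: riemann_sum_sqr_cvg (ltW sT) T1.
(* Squaring doubles the parameter up to a deterministic factor, and the weight with parameter
   [2 * lam] again has mean one. *)
- move=> M; have SE w : f lam M w ^+ 2 = expR (lam ^+ 2 * S M) * f (2 * lam) M w.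
    by rewrite -expRM_natl -expRD; congr expR; field.
  apply: (@le_trans _ _ (\int[P]_w ((expR (lam ^+ 2 * S M))%:E * (f (2 * lam) M w)%:E))%E).
    apply: ge0_le_integral => //.
    + by move=> w _; rewrite lee_fin sqr_ge0.
    + by apply/measurable_EFinP; apply: measurable_funX; apply: measurable_funM.
    + by apply/measurable_EFinP; apply: measurable_funM.
    + move=> w _; rewrite lee_fin -SE exprMn ler_piMl ?sqr_ge0//.
  rewrite ge0_integralZl//.
  + rewrite f1 mule1 lee_fin ler_expR ler_wpM2l ?sqr_ge0//.
    exact: riemann_sum_sqr_le (ltW sT) T1.
  + exact/measurable_EFinP.
  + by move=> w _; rewrite lee_fin expR_ge0.
- by move=> M; rewrite -i1E fineK ?fin_num_measure//; have [] := past lam M.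
Qed.

End bridge_martingale.

Lemma sub_g_sigma_algebra T (G H : set (set T)) : G `<=` <<s H >> -> <<s G >> `<=` <<s H >>.
Proof. by move=> GH; apply: smallest_sub => //; exact: smallest_sigma_algebra. Qed.

Lemma measurable_fun_g_sigma_sub (T : pointedType) (G H : set (set T)) (R : realType) (f : T -> R) :
  G `<=` <<s H >> -> measurable_fun setT (f : g_sigma_algebraType G -> R) ->
  measurable_fun setT (f : g_sigma_algebraType H -> R).
Proof.
move=> GH mf _ B mB; have := mf measurableT B mB; rewrite !setTI.
exact: sub_g_sigma_algebra.
Qed.

Lemma within_cvg_seq (R : realType) (f : R -> R) (A : set R) (y : nat -> R) (u : R) :
  {within A, continuous f} -> A u -> (forall N, A (y N)) -> y N @[N --> \oo] --> u ->
  f (y N) @[N --> \oo] --> f u.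
Proof.
move=> fc Au Ay yu; apply/cvgrPdist_lt => e e0.
have [r r0 H] := within_continuousP fc Au e0.
move/cvgrPdist_lt : yu => /(_ _ r0); apply: filterS => N; exact: H.
Qed.

Lemma grid_refine (R : realType) (a b : R) N M j :
  grid a b N j = grid a b (N + M) (j * 2 ^ M).
Proof.
rewrite /grid expnD !natrM; field.
by rewrite !gt_eqF ?pow2_gt0.
Qed.

(** * From the increments of W to the filtration of X *)

Section natural_filtration.
Context {R : realType} {d : measure_display} {Omega : measurableType d}.
Variables (P : probability Omega R) (W : R -> Omega -> R) (hW : is_std_BM P W).
Variables (t x : R) (ht0 : 0 <= t) (ht1 : t < 1).
Variables (X : R -> Omega -> R) (hX : is_bridge W t x X).

Definition natgen (s : R) : set (set Omega) :=
  [set A | exists u (B : set R), [/\ t <= u <= s, measurable B & A = X u @^-1` B]].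

Lemma natfil_le s s' : s <= s' -> natfil X t s `<=` natfil X t s'.
Proof.
move=> ss'; apply: sub_smallest2r; first exact: smallest_sigma_algebra.
by move=> A [u [B [/andP[tu us] mB ->]]]; exists u, B; split => //; rewrite tu (le_trans us).
Qed.

(** An increasing union of sigma-algebras: closed under finite intersections, which is all that
    [dynkin_weight] asks of a generator. *)
Definition past (s : R) : set (set Omega) :=
  \bigcup_N <<s cylinder W (grid t s N) (2 ^ N) >>.

Lemma measurable_W_cylinder s N M j : (j <= 2 ^ N)%N -> 
  measurable_fun setT (fun w : g_sigma_algebraType (cylinder W (grid t s (N + M)) (2 ^ (N + M))) =>
    W (grid t s N j) w - W t w).
Proof.
move=> jN; have jM : (j * 2 ^ M <= 2 ^ (N + M))%N by rewrite expnD leq_mul2r jN orbT.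
have -> : (fun w => W (grid t s N j) w - W t w) =
    (fun w => \sum_(i < j * 2 ^ M) incr W (grid t s (N + M)) i w).
  apply/funext => w; rewrite (grid_refine t s N M) -[in W t w](grid0 t s (N + M)).
  by rewrite -(telescope_sumr (fun i => W (grid t s (N + M) i) w) (leq0n _)) big_mkord.
apply: measurable_fun_sumr => i _; apply: incr_measurable_cylinder.
exact: leq_trans jM.
Qed.

Lemma cylinder_refine s N M :
  <<s cylinder W (grid t s N) (2 ^ N) >> `<=` <<s cylinder W (grid t s (N + M)) (2 ^ (N + M)) >>.
Proof.
apply: sub_g_sigma_algebra => _ [B [mB ->]].
set G := cylinder _ _ _.
apply: (@bigcap_measurableType _ (g_sigma_algebraType G)) => i /= iN.
have -> : [set w | B i (incr W (grid t s N) i w)] =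
  (fun w => (W (grid t s N i.+1) w - W t w) - (W (grid t s N i) w - W t w)) @^-1` B i.
  by apply/seteqP; split => w /=; rewrite /incr opprB addrA subrK.
rewrite -[X in measurable X]setTI.
by apply: measurable_funB => //; apply: measurable_W_cylinder => //; exact: ltnW.
Qed.

Lemma past_setI_closed s : setI_closed (past s).
Proof.
move=> A B [N _ cA] [M _ cB]; exists (N + M)%N => //.
apply: (@measurableI _ (g_sigma_algebraType (cylinder W (grid t s (N + M)) (2 ^ (N + M))))).
  exact: cylinder_refine.
by rewrite addnC; exact: cylinder_refine.
Qed.

(** At grid times X is a limit of Riemann sums over finer grids; other times follow by continuity of
    the path. *)
Lemma measurable_X_past s u : t <= u -> u <= s -> s < 1 ->
  measurable_fun setT (X u : g_sigma_algebraType (past s) -> R).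
Proof.
move=> tu us s1; have ts := le_trans tu us.
pose g N := grid t s N (gidx t s N u).
have gi N : t <= g N <= s by apply: grid_itv => //; exact: gidx_le.
have mg N : measurable_fun setT (X (g N) : g_sigma_algebraType (past s) -> R).
  have /andP[tg gs] := gi N; have g1 := le_lt_trans gs s1.
  have g0 : 1 - g N != 0 by rewrite gt_eqF// subr_gt0.
  have -> : X (g N) = (fun w => (1 - g N) * (X (g N) w / (1 - g N))) by apply/funext => w; field.
  apply: measurable_funM => //.
  apply: (@bridge_ratio_measurable _ _ _ _ _ _ _ hX _ (g_sigma_algebraType (past s)) id) => // M j jM.
  rewrite /g grid_sub.
  apply: (@measurable_fun_g_sigma_sub _ (cylinder W (grid t s (N + M)) (2 ^ (N + M)))).
    by move=> A cA; apply: sub_sigma_algebra; exists (N + M)%N => //; exact: sub_sigma_algebra.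
  have := @measurable_W_cylinder s (N + M) 0 (gidx t s N u * j); rewrite addn0; apply.
  by rewrite expnD leq_mul// gidx_le.
apply: (measurable_fun_cvg mg) => w _.
have uA : `[t, s]%classic u by rewrite /= in_itv/= tu us.
have gA N : `[t, s]%classic (g N) by rewrite /= in_itv/= gi.
have gu : g N @[N --> \oo] --> u.
  by rewrite -[X in _ --> X](@clip_id R t s u) ?tu ?us//; exact: cvg_grid_gidx.
exact: (within_cvg_seq (@bridge_continuous _ _ _ _ _ _ _ hX t s w (lexx t) s1) uA gA gu).
Qed.

Lemma natfil_past s : t <= s -> s < 1 -> natfil X t s `<=` <<s past s >>.
Proof.
move=> ts s1; apply: sub_g_sigma_algebra => _ [u [B [/andP[tu us] mB ->]]].
have := measurable_X_past tu us s1 measurableT mB.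
by rewrite setTI.
Qed.

Lemma integral_expm_natfil lam s T A : t <= s -> s < T -> T < 1 -> natfil X t s A ->
  (measurable A /\ \int[P]_(w in A) (expm X lam s T w)%:E = P A)%E.
Proof.
move=> ts sT T1; have s1 := lt_trans sT T1; move: ts; rewrite le_eqVlt => /predU1P[ts|ts].
  (* At [s = t] the grids degenerate, but [X t] is the constant [x], so the filtration is trivial
     and a path with no increments describes it. *)
  have cT : <<s cylinder W (fun=> t) 0 >> setT.
    apply: sub_sigma_algebra; exists (fun=> setT); split => //.
    by apply/esym/seteqP; split.
  move=> nA; apply: (@integral_expm_cylinder _ _ _ P W hW t x X hX lam (fun=> t) 0 s T) => //.
    by rewrite ts.
  move: A nA; apply: sub_g_sigma_algebra => _ [u [B [+ mB ->]]].
  rewrite -ts -eq_le => /eqP <-.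
  have [Bx|Bx] := pselect (B x).
    rewrite (_ : _ @^-1` _ = setT)//; apply/seteqP; split => // w _ /=.
    by rewrite (bridge_start hX).
  rewrite (_ : _ @^-1` _ = set0); first exact: sigma_algebra0.
  by apply/seteqP; split => // w /=; rewrite (bridge_start hX).
move=> /(natfil_past (ltW ts) s1); apply: dynkin_weight.
- apply: (measurable_expm hW hX) => //; [exact: ltW|exact: (le_trans (ltW ts) (ltW sT))].
- by move=> w; exact: expR_ge0.
- have H := @integral_expm_cylinder _ _ _ P W hW t x X hX lam (grid t s 0) 1 s T.
  have := H _ _ _ _ _ _ setT; rewrite grid0 probability_setT => h; apply: (h _ _ _ _ _ _ _).2 => //.
  + by move=> i _; exact: grid_ltS.
  + exact: (grid_last t s 0).
  + exact: ltW.
  + exact: (@measurableT _ (g_sigma_algebraType (cylinder W (grid t s 0) 1))).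
- exact: past_setI_closed.
- move=> B [N _]; apply: (@integral_expm_cylinder _ _ _ P W hW t x X hX) => //.
  + by rewrite grid0.
  + by move=> i _; exact: grid_ltS.
  + exact: grid_last.
  + exact: ltW.
Qed.

End natural_filtration.

(** * Optional stopping *)

Section optional_stopping.
Context {R : realType} {d : measure_display} {Omega : measurableType d}.
Variables (P : probability Omega R) (W : R -> Omega -> R) (hW : is_std_BM P W).
Variables (t x : R) (ht0 : 0 <= t) (ht1 : t < 1).
Variables (X : R -> Omega -> R) (hX : is_bridge W t x X).

Lemma natfil_measurable s A : t <= s -> s < 1 -> natfil X t s A -> measurable A.
Proof.
(* The parameter [0] and the midpoint between [s] and 1 are arbitrary choices that extract the
   measurability half of [integral_expm_natfil]. *)
move=> ts s1 nA; have s1' : s < (s + 1) / 2 by lra.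
have s2 : (s + 1) / 2 < 1 by lra.
by have [] := integral_expm_natfil hW ht0 hX 0 ts s1' s2 nA.
Qed.

Lemma natfil_X u s (B : set R) : t <= u -> u <= s -> measurable B ->
  natfil X t s (X u @^-1` B).
Proof.
by move=> tu us mB; apply: sub_sigma_algebra; exists u, B; rewrite tu us.
Qed.

Lemma integral_indicM (A : set Omega) (g : Omega -> R) :
  (\int[P]_(w in A) (g w)%:E = \int[P]_w (\1_A w * g w)%:E)%E.
Proof.
rewrite integral_mkcond; apply: eq_integral => w _; rewrite patchE indicE.
by case: ifPn => _; rewrite ?mul1r ?mul0r.
Qed.

(** [expm X lam t T] is [expm X lam s T] times a function of [X s]. The first factor has mean one on
    every event known at time [s], so weighting by it leaves the law of [X s] on [A] unchanged. *)
Lemma integral_expm_martingale lam s T A : t <= s -> s <= T -> T < 1 -> natfil X t s A ->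
  (\int[P]_(w in A) (expm X lam t T w)%:E = \int[P]_(w in A) (expm X lam t s w)%:E)%E.
Proof.
move=> ts; rewrite le_eqVlt => /predU1P[-> //|sT] T1 nA.
have s1 := lt_trans sT T1; have tT := le_trans ts (ltW sT).
have mA := natfil_measurable ts s1 nA.
have mX := bridge_measurable hW hX ts s1.
have mE := measurable_expm hW hX lam ts s1 tT T1.
pose f y := expR (lam * (y / (1 - s) - x / (1 - t)) - lam ^+ 2 / 2 * ((1 - s)^-1 - (1 - t)^-1)).
have mf : measurable_fun setT f.
  apply: measurableT_comp => //; apply: measurable_funB; last exact: measurable_cst.
  apply: measurable_funM; first exact: measurable_cst.
  apply: measurable_funB; last exact: measurable_cst.
  by apply: measurable_funM; [exact: measurable_id|exact: measurable_cst].
rewrite [LHS]integral_indicM [RHS]integral_indicM.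
transitivity (\int[P]_w ((\1_A w * expm X lam s T w)%:E * (f (X s w))%:E))%E.
  apply: eq_integral => w _; rewrite -EFinM -mulrA; congr (_ * _)%:E.
  by rewrite /expm /f -expRD (bridge_start hX); congr expR; ring.
rewrite (@eq_integral_weight _ _ R _ _ _ _ P P (fun w => \1_A w * expm X lam s T w) \1_A
    (X s) (X s) (fun y => (f y)%:E)).
- apply: eq_integral => w _; rewrite -EFinM; congr (_ * _)%:E.
  by rewrite /expm /f (bridge_start hX).
- by apply: measurable_funM; [exact: measurable_indic|exact: mE].
- by move=> w; apply: mulr_ge0; [rewrite indicE ler0n|exact: expR_ge0].
- exact: mX.
- exact: measurable_indic.
- by move=> w; rewrite indicE ler0n.
- exact: mX.
- move=> B mB; have nAB : natfil X t s (A `&` X s @^-1` B).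
    apply: (@measurableI _ (g_sigma_algebraType (natgen t X s))) => //.
    exact: natfil_X.
  have [mAB] := integral_expm_natfil hW ht0 hX lam ts sT T1 nAB.
  rewrite integral_indicM => H.
  transitivity (P (A `&` X s @^-1` B)).
    rewrite -H; apply: eq_integral => w _; congr EFin.
    by rewrite indicI/= /preimage/= mulrAC.
  transitivity (\int[P]_w (\1_(A `&` X s @^-1` B) w)%:E)%E.
    by rewrite integral_indic// setIT.
  by apply: eq_integral => w _; rewrite indicI.
- exact/measurable_EFinP.
- by move=> y; rewrite lee_fin expR_ge0.
Qed.

Lemma integral_expm lam T : t <= T -> T < 1 -> (\int[P]_w (expm X lam t T w)%:E = 1)%E.
Proof.
rewrite le_eqVlt => /predU1P[<- _|tT T1].
  under eq_integral do rewrite /expm !subrr !mulr0 subrr expR0.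
  by rewrite integral_cst// mul1e; exact: probability_setT.
have [|_ ->] := @integral_expm_natfil _ _ _ P W hW t x ht0 X hX lam t T setT (lexx _) tT T1.
  exact: (@measurableT _ (g_sigma_algebraType (natgen t X t))).
exact: probability_setT.
Qed.

Variable sigma : Omega -> R.
Hypothesis hs : is_stopping_time X t sigma.

Section horizon.
Variables (T : R) (tT : t <= T) (T1 : T < 1).

Definition dyadic_stop N w := gidx t T N (sigma w).

Let gT N i : (i <= 2 ^ N)%N -> t <= grid t T N i <= T.
Proof. exact: grid_itv. Qed.

(** Equality to [i] is [<= i] together with [>= i], the latter being the complement of [<= i - 1].
    The last index stands apart: it also collects the times after [T], and there [>= i] alone
    characterises the event. *)
Lemma natfil_dyadic_stop N i : (i <= 2 ^ N)%N ->
  natfil X t (grid t T N i) [set w | dyadic_stop N w = i].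
Proof.
move=> iN; have /andP[tg gT'] := gT iN.
have leE j : (j < 2 ^ N)%N -> (j <= i)%N ->
    natfil X t (grid t T N i) [set w | (dyadic_stop N w <= j)%N].
  move=> jN ji; rewrite (_ : mkset _ = [set w | sigma w <= grid t T N j]).
    apply: (natfil_le (grid_le _ tT ji)); apply: hs.
    by have /andP[-> h] := gT (ltnW jN); rewrite (le_lt_trans h).
  by apply/seteqP; split => w /=; rewrite /dyadic_stop gidxP.
have ltE : natfil X t (grid t T N i) [set w | (i <= dyadic_stop N w)%N].
  case: i iN {tg gT'} leE => [|i] iN leE.
    rewrite (_ : mkset _ = setT); last by apply/seteqP; split.
    exact: (@measurableT _ (g_sigma_algebraType (natgen t X _))).
  rewrite (_ : mkset _ = ~` [set w | (dyadic_stop N w <= i)%N]).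
    apply: (@measurableC _ (g_sigma_algebraType (natgen t X (grid t T N i.+1)))).
    exact: leE.
  by apply/seteqP; split => w /=; rewrite ltnNge => /negP.
move: iN; rewrite leq_eqVlt => /predU1P[iN|iN].
  rewrite (_ : mkset _ = [set w | (i <= dyadic_stop N w)%N])//.
  apply/seteqP; split => w /= => [->//|h].
  by apply/eqP; rewrite eqn_leq h andbT iN gidx_le.
rewrite (_ : mkset _ = [set w | (dyadic_stop N w <= i)%N] `&` [set w | (i <= dyadic_stop N w)%N]).
  by apply: (@measurableI _ (g_sigma_algebraType (natgen t X (grid t T N i)))) => //; exact: leE.
apply/seteqP; split => w /= => [->//|[h1 h2]].
by apply/eqP; rewrite eqn_leq h1 h2.
Qed.

Lemma sum_dyadic_stop (f : nat -> Omega -> R) N w :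
  f (dyadic_stop N w) w = \sum_(i < (2 ^ N).+1) \1_[set w | dyadic_stop N w = i] w * f i w.
Proof.
have k : (dyadic_stop N w < (2 ^ N).+1)%N by rewrite ltnS gidx_le.
rewrite (bigD1 (Ordinal k))//= indicE mem_set//= mul1r big1 ?addr0// => i ik.
rewrite indicE memNset ?mul0r//= => E; move/eqP: ik; apply.
by apply/val_inj.
Qed.

Lemma measurable_dyadic_stop (f : nat -> Omega -> R) N :
  (forall i, (i <= 2 ^ N)%N -> measurable_fun setT (f i : g_sigma_algebraType (natgen t X T) -> R)) ->
  measurable_fun setT ((fun w => f (dyadic_stop N w) w) : g_sigma_algebraType (natgen t X T) -> R).
Proof.
move=> mf; under eq_fun do rewrite sum_dyadic_stop.
apply: measurable_fun_sumr => i _; have iN : (i <= 2 ^ N)%N by rewrite -ltnS.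
apply: measurable_funM; last exact: mf.
apply: measurable_indic; have /andP[_ gT'] := gT iN.
by have := natfil_le gT' (natfil_dyadic_stop iN).
Qed.

Local Notation tau := (fun w => clip t T (sigma w)).

Lemma cvg_dyadic_stop w : grid t T N (dyadic_stop N w) @[N --> \oo] --> tau w.
Proof. exact: cvg_grid_gidx. Qed.

Lemma cvg_X_dyadic_stop w : X (grid t T N (dyadic_stop N w)) w @[N --> \oo] --> X (tau w) w.
Proof.
have uA : `[t, T]%classic (tau w) by rewrite /= in_itv/= clip_itv.
have gA N : `[t, T]%classic (grid t T N (dyadic_stop N w)).
  by rewrite /= in_itv/=; apply: gT; exact: gidx_le.
exact: (within_cvg_seq (@bridge_continuous _ _ _ _ _ _ _ hX t T w (lexx t) T1) uA gA (@cvg_dyadic_stop w)).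
Qed.

Lemma measurable_clip_stop_natfil :
  measurable_fun setT (tau : g_sigma_algebraType (natgen t X T) -> R).
Proof.
have mN N : measurable_fun setT
    ((fun w => grid t T N (dyadic_stop N w)) : g_sigma_algebraType (natgen t X T) -> R).
  by apply: (measurable_dyadic_stop (f := fun i _ => grid t T N i)).
exact: (measurable_fun_cvg mN (fun w _ => @cvg_dyadic_stop w)).
Qed.

Lemma measurable_X_clip_natfil :
  measurable_fun setT ((fun w => X (tau w) w) : g_sigma_algebraType (natgen t X T) -> R).
Proof.
have mN N : measurable_fun setT
    ((fun w => X (grid t T N (dyadic_stop N w)) w) : g_sigma_algebraType (natgen t X T) -> R).
  apply: (measurable_dyadic_stop (f := fun i => X (grid t T N i))) => i iN _ B mB.
  by rewrite setTI; have /andP[tg gT'] := gT iN; exact: natfil_X.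
exact: (measurable_fun_cvg mN (fun w _ => @cvg_X_dyadic_stop w)).
Qed.

Lemma measurable_fun_natfil (f : Omega -> R) :
  measurable_fun setT (f : g_sigma_algebraType (natgen t X T) -> R) ->
  measurable_fun setT f.
Proof.
move=> mf _ B mB; have := mf measurableT B mB; rewrite !setTI.
exact: natfil_measurable.
Qed.

Lemma measurable_clip_stop : measurable_fun setT tau.
Proof. exact: (measurable_fun_natfil measurable_clip_stop_natfil). Qed.

Lemma measurable_X_clip : measurable_fun setT (fun w => X (tau w) w).
Proof. exact: (measurable_fun_natfil measurable_X_clip_natfil). Qed.

(** On each event [dyadic_stop N w = i], known at its grid time, the martingale property moves the
    time to the horizon [T]; the pieces then add up to the total mass one. *)
Lemma integral_expm_dyadic_stop lam N :
  (\int[P]_w (expm X lam t (grid t T N (dyadic_stop N w)) w)%:E = 1)%E.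
Proof.
have mE i : (i <= 2 ^ N)%N -> measurable_fun setT (expm X lam t (grid t T N i)).
  by move=> /gT/andP[tg gT']; apply: (measurable_expm hW hX) => //; exact: le_lt_trans T1.
have mA i : (i <= 2 ^ N)%N -> measurable [set w | dyadic_stop N w = i].
  move=> iN; have /andP[tg gT'] := gT iN.
  by apply: natfil_measurable (natfil_dyadic_stop iN) => //; exact: le_lt_trans T1.
have sumE (f : nat -> Omega -> R) :
  (forall i, (i <= 2 ^ N)%N -> measurable_fun setT (f i)) -> (forall i w, 0 <= f i w) ->
  (\int[P]_w (f (dyadic_stop N w) w)%:E =
   \sum_(i < (2 ^ N).+1) \int[P]_(w in [set w | dyadic_stop N w = i]) (f i w)%:E)%E.
  move=> mf f0; under eq_integral do rewrite sum_dyadic_stop -sumEFin.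
  under [RHS]eq_bigr do rewrite integral_indicM.
  rewrite -ge0_integral_sum//.
  - move=> i; have iN : (i <= 2 ^ N)%N by rewrite -ltnS.
    by apply/measurable_EFinP; apply: measurable_funM; [exact/measurable_indic/mA|exact: mf].
  - by move=> i w _; rewrite lee_fin mulr_ge0.
rewrite (sumE (fun i => expm X lam t (grid t T N i)))//; last by move=> *; exact: expR_ge0.
rewrite -(integral_expm lam tT T1) (sumE (fun=> expm X lam t T))//; first last.
- by move=> *; exact: expR_ge0.
- by move=> i _; exact: (measurable_expm hW hX).
apply: eq_bigr => -[i] /= iN _; rewrite ltnS in iN; have /andP[tg gT'] := gT iN.
by rewrite -(integral_expm_martingale lam tg gT')//; exact: natfil_dyadic_stop.
Qed.

Theorem optional_stopping lam : (\int[P]_w (expm X lam t (tau w) w)%:E = 1)%E.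
Proof.
pose f la N w := expm X la t (grid t T N (dyadic_stop N w)) w.
have mf la N : measurable_fun setT (f la N).
  apply: measurable_fun_natfil.
  apply: (measurable_dyadic_stop (f := fun i => expm X la t (grid t T N i))) => i iN.
  have /andP[tg gT'] := gT iN.
  apply: measurableT_comp => //; apply: measurable_funB => //; apply: measurable_funM => //.
  apply: measurable_funB; apply: measurable_funM => // _ B mB; rewrite setTI.
    exact: natfil_X.
  exact: natfil_X.
apply: (@integral_cvg_bounded_sqr _ _ _ P (f lam) _ _
   (expR (lam ^+ 2 * ((1 - T)^-1 - (1 - t)^-1)))) => //.
- by move=> N w; exact: expR_ge0.
- move=> w; apply: continuous_cvg; first exact: continuous_expR.
  have tauT : 1 - tau w != 0.
    by rewrite gt_eqF// subr_gt0; have /andP[_ h] := clip_itv (sigma w) tT; exact: le_lt_trans T1.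
  have cV : (1 - grid t T N (dyadic_stop N w))^-1 @[N --> \oo] --> (1 - tau w)^-1.
    by apply: cvgV => //; apply: cvgB; [exact: cvg_cst|exact: cvg_dyadic_stop].
  apply: cvgB; apply: cvgMr; apply: cvgB; try exact: cvg_cst; last exact: cV.
  by apply: cvgM; [exact: cvg_X_dyadic_stop|exact: cV].
- move=> N.
  (* The parameter is doubled again. The clock is now random, but it never exceeds its value at
     [T]. *)
  pose C := expR (lam ^+ 2 * ((1 - T)^-1 - (1 - t)^-1)).
  apply: (@le_trans _ _ (\int[P]_w (C%:E * (f (2 * lam) N w)%:E))%E).
    apply: ge0_le_integral => //.
    + by move=> w _; rewrite lee_fin sqr_ge0.
    + by apply/measurable_EFinP; apply: measurable_funX.
    + by apply/measurable_EFinP; apply: measurable_funM.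
    + move=> w _; have /andP[tg gT'] := gT (gidx_le t T N (sigma w)).
      rewrite -EFinM lee_fin /C /f /expm -expRM_natl -expRD ler_expR.
      set V := (1 - grid _ _ _ _)^-1; set Y := X _ _ / _ - _.
      have VT : V <= (1 - T)^-1.
        by rewrite lef_pV2 ?posrE ?subr_gt0 ?(le_lt_trans gT')// lerD2l lerN2.
      have l2 : 0 <= lam ^+ 2 by exact: sqr_ge0.
      rewrite (_ : (2 * lam) ^+ 2 = 4 * lam ^+ 2); last by ring.
      have := ler_wpM2l l2 VT; rewrite -subr_ge0 => h.
      rewrite -subr_ge0 (_ : _ - _ = lam ^+ 2 * (1 - T)^-1 - lam ^+ 2 * V)//.
      by set V1 := (1 - T)^-1; set V0 := (1 - t)^-1; field.
  rewrite ge0_integralZl//.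
  + by rewrite integral_expm_dyadic_stop mule1.
  + exact/measurable_EFinP.
  + by move=> w _; rewrite lee_fin expR_ge0.
  + by rewrite lee_fin expR_ge0.
- by move=> N; exact: integral_expm_dyadic_stop.
Qed.

End horizon.
End optional_stopping.

(** * The functions F *)

Section gamma_gauss.
Context {R : realType}.
Implicit Types (y z v B : R) (k : nat).

Definition gkernel k y (u : R) : R := u ^+ k * expR (y * u - u ^+ 2 / 2).

Lemma measurable_gkernel k y : measurable_fun setT (gkernel k y).
Proof.
apply: measurable_funM; first exact: measurable_funX.
apply: measurableT_comp => //; apply: measurable_funB.
  by apply: measurable_funM; [exact: measurable_cst|exact: measurable_id].
by apply: measurable_funM; [exact: measurable_funX|exact: measurable_cst].
Qed.

Lemma gkernel_ge0 k y u : 0 <= u -> 0 <= gkernel k y u.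
Proof. by move=> u0; rewrite mulr_ge0 ?exprn_ge0 ?expR_ge0. Qed.

Lemma exprn_le_fact_expR k (u : R) : 0 <= u -> u ^+ k <= k`!%:R * expR u.
Proof.
move=> u0; case: k => [|k].
  by rewrite expr0 mul1r -(expR0 R) ler_expR.
have := expR_ge1Dxn k u0; rewrite -ler_pdivrMl ?ltr0n ?fact_gt0//.
by apply: le_trans; rewrite mulrC lerDr.
Qed.

(** After [u^k <= k! exp(u)] the exponent is [(y + 1) u - u^2 / 2]. It falls short of
    [(y + 1)^2 - u^2 / 8], the exponent of a normal law of standard deviation 2, by
    [(y + 1 - u / 2)^2 + u^2 / 8]. *)
Lemma gkernel_le_normal k y u : 0 <= u ->
  gkernel k y u <= k`!%:R * expR ((y + 1) ^+ 2) / normal_peak 2 * normal_pdf 0 2 u.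
Proof.
move=> u0; rewrite normal_pdfE// mulrA divfK ?gt_eqF ?normal_peak_gt0// /gkernel.
apply: (le_trans (ler_wpM2r (expR_ge0 _) (exprn_le_fact_expR k u0))).
rewrite -!mulrA ler_wpM2l// /normal_fun -!expRD ler_expR subr0.
rewrite -subr_ge0 (_ : _ - _ = (y + 1 - 2^-1 * u) ^+ 2 + u ^+ 2 / 8); last by field.
by rewrite addr_ge0// ?sqr_ge0// divr_ge0 ?sqr_ge0.
Qed.

Lemma integrable_gkernel k y :
  lebesgue_measure.-integrable `[0, +oo[ (EFin \o gkernel k y).
Proof.
pose C : R := k`!%:R * expR ((y + 1) ^+ 2) / normal_peak 2.
have C0 : 0 <= C.
  by rewrite divr_ge0 ?mulr_ge0 ?expR_ge0// ltW// normal_peak_gt0.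
have ig : lebesgue_measure.-integrable `[0, +oo[ (fun u => (C%:E * (normal_pdf 0 2 u)%:E)%E).
  apply: integrableZl => //.
  by apply: (integrableS _ _ (@subsetT _ _)) => //; exact: integrable_normal_pdf.
apply: (le_integrable _ _ _ ig) => //.
  by apply/measurable_EFinP; apply: measurable_funTS; exact: measurable_gkernel.
move=> u; rewrite /= in_itv/= andbT => u0.
rewrite lee_fin ger0_norm ?gkernel_ge0// (ger0_norm (mulr_ge0 C0 (normal_pdf_ge0 _ _ _))).
exact: gkernel_le_normal.
Qed.

Lemma FqE k y : Fq k.+1 y = Rintegral lebesgue_measure `[0, +oo[ (gkernel k y).
Proof. by []. Qed.

Lemma integral_gkernel k y :
  (\int[lebesgue_measure]_(u in `[0%R, +oo[) (gkernel k y u)%:E = (Fq k.+1 y)%:E)%E.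
Proof.
by rewrite /Fq /Rintegral fineK//; apply: integrable_fin_num => //; exact: integrable_gkernel.
Qed.

Lemma Fq_gt0 k y : 0 < Fq k.+1 y.
Proof.
(* A lower bound of the kernel on [[1, 2]], where [u^k >= 1], [y u >= - 2 |y|] and
   [u^2 / 2 <= 2]. *)
pose c := expR (- (2 * `|y| + 2)).
have c0 : 0 < c by exact: expR_gt0.
rewrite -lte_fin -integral_gkernel; apply: (@lt_le_trans _ _ c%:E); first by rewrite lte_fin.
have s12 : (`[1, 2]%classic : set R) `<=` `[0, +oo[%classic.
  by apply: subset_itv; rewrite bnd_simp.
apply: (@le_trans _ _ (\int[lebesgue_measure]_(u in `[1%R, 2%R]) (gkernel k y u)%:E)%E); last first.
  apply: ge0_subset_integral => //.
  - by apply/measurable_EFinP; apply: measurable_funTS; exact: measurable_gkernel.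
  - by move=> u; rewrite /= in_itv/= andbT => u0; rewrite lee_fin gkernel_ge0.
apply: (@le_trans _ _ (\int[lebesgue_measure]_(u in `[1%R, 2%R]) c%:E)%E).
  rewrite integral_cst//= lebesgue_measure_itv/= lte_fin ltr1n -EFinD -EFinM lee_fin.
  by rewrite ler_peMr ?(ltW c0)//; lra.
apply: ge0_le_integral => //.
- by move=> u _; rewrite lee_fin ltW.
- by apply/measurable_EFinP; apply: measurable_funTS; exact: measurable_gkernel.
- move=> u; rewrite /= in_itv/= => /andP[u1 u2]; rewrite lee_fin /gkernel -[leLHS]mul1r.
  rewrite ler_pM// ?exprn_ege1// ?(ltW c0)// ler_expR.
  have h : - (2 * `|y|) <= y * u.
    have := ler_norm (- (y * u)); rewrite normrN normrM (ger0_norm (le_trans ler01 u1)).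
    move=> h1; have := ler_wpM2l (normr_ge0 y) u2; lra.
  have : u ^+ 2 <= 4 by rewrite expr2; nra.
  lra.
Qed.

Lemma integral_Hmix k z v : 0 < v ->
  (\int[lebesgue_measure]_(l in `[0%R, +oo[) (l ^+ k * expR (l * z - l ^+ 2 * v / 2))%:E =
   (Fq k.+1 (z / Num.sqrt v) / Num.sqrt v ^+ k.+1)%:E)%E.
Proof.
move=> v0; set s := Num.sqrt v.
have s0 : 0 < s by rewrite sqrtr_gt0.
have sv : s ^+ 2 = v by rewrite sqr_sqrtr// ltW.
pose F l := s * l.
have F'E : F^`()%classic = cst s.
  by apply/funext => l; rewrite derive1E deriveM// derive_id derive_cst scaler0 addr0 scaler1.
have Fc : continuous F by move=> l; apply: cvgMr; exact: cvg_id.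
have Gc : continuous (gkernel k (z / s)).
  move=> l; apply: cvgM; first exact: exprn_continuous.
  apply: continuous_comp; last exact: continuous_expR.
  apply: cvgB; first by apply: cvgMr; exact: cvg_id.
  by apply: cvgMl; exact: exprn_continuous.
have := @increasing_ge0_integration_by_substitutiony R F (gkernel k (z / s)) 0.
have F0 : F 0 = 0 by rewrite /F mulr0.
rewrite F'E F0 integral_gkernel => H.
have -> : Fq k.+1 (z / s) / s ^+ k.+1 = (s ^+ k.+1)^-1 * Fq k.+1 (z / s) by rewrite mulrC.
rewrite EFinM H; first last.
- by move=> l; rewrite in_itv/= andbT => l0; rewrite gkernel_ge0// ltW.
- exact: continuous_subspaceT.
- by apply: gt0_cvgMry => //; exact: cvg_id.
- split; first by move=> l _; exact: derivableM.
  by apply: cvg_at_right_filter; exact: Fc.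
- exact: is_cvg_cst.
- exact: is_cvg_cst.
- by move=> l _; exact: cvg_cst.
- by move=> a b _ _ ab; rewrite ltr_pM2l.
rewrite -ge0_integralZl//.
- apply: eq_integral => l _; rewrite -EFinM; congr EFin.
  rewrite /= /gkernel /F !fctE exprMn (exprS s k).
  have -> : z / s * (s * l) - (s * l) ^+ 2 / 2 = l * z - l ^+ 2 * v / 2.
    by rewrite -sv; field; rewrite gt_eqF.
  have sk0 : s ^+ k != 0 by rewrite gt_eqF// exprn_gt0.
  set E := expR _; set a := s ^+ k in sk0 *; set b := l ^+ k.
  by field; rewrite sk0 gt_eqF.
- apply/measurable_EFinP; apply: measurable_funTS => //=; rewrite !fctE.
  apply: measurable_funM => //; apply: (measurableT_comp (measurable_gkernel k _)).
  by apply: measurable_funM.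
- move=> l; rewrite /= in_itv/= andbT => l0; rewrite lee_fin mulr_ge0 ?(ltW s0)//.
  by rewrite gkernel_ge0// mulr_ge0// ltW.
- by rewrite lee_fin invr_ge0 exprn_ge0// ltW.
Qed.

(** An affine minorant of [exp((y - B) u)] is integrated against the kernel at [B], a factor [u]
    raising the index by one. The choice [a = 1], [mu = 0] gives the tangent inequality for F at
    [B]; [mu] equal to the mean of [u] gives Jensen's inequality. *)
Lemma le_Fq_tangent k B y (a mu : R) : 
  (forall u, 0 <= u -> a * (1 + (y - B) * (u - mu)) <= expR ((y - B) * u)) ->
  a * (Fq k.+1 B + (y - B) * (Fq k.+2 B - mu * Fq k.+1 B)) <= Fq k.+1 y.
Proof.
move=> H; have iB := integrable_gkernel k B; have iB' := integrable_gkernel k.+1 B.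
have -> : a * (Fq k.+1 B + (y - B) * (Fq k.+2 B - mu * Fq k.+1 B)) =
    a * (1 - (y - B) * mu) * Fq k.+1 B + a * (y - B) * Fq k.+2 B by ring.
rewrite !FqE -!RintegralZl//.
have iZ k' c : lebesgue_measure.-integrable `[0, +oo[ (EFin \o (fun u => c * gkernel k' B u)).
  exact: (integrableZl _ c (integrable_gkernel k' B)).
rewrite -RintegralD//; [|exact: iZ|exact: iZ].
apply: le_Rintegral => //.
- exact: (integrableD _ (iZ _ _) (iZ _ _)).
- exact: integrable_gkernel.
move=> u; rewrite /= in_itv/= andbT => u0.
have -> : a * (1 - (y - B) * mu) * gkernel k B u + a * (y - B) * gkernel k.+1 B u =
   (a * (1 + (y - B) * (u - mu))) * gkernel k B u by rewrite /gkernel (exprS u k); ring.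
rewrite [leRHS](_ : _ = expR ((y - B) * u) * gkernel k B u); last first.
  by rewrite /gkernel mulrCA -expRD; congr (_ * expR _); ring.
by rewrite ler_wpM2r ?gkernel_ge0// H.
Qed.

(** A limit that does not exist defaults to [0], so a nonzero [derive1] certifies that the
    difference quotients converge. The tangent inequality bounds them from above on the left and
    from below on the right. *)
Lemma Fq_derive k B : derive1 (Fq k.+1) B != 0 -> derive1 (Fq k.+1) B = Fq k.+2 B.
Proof.
move=> d0; have dc := cvgNpoint d0.
have slope h : h * Fq k.+2 B <= Fq k.+1 (h + B) - Fq k.+1 B.
  have := @le_Fq_tangent k B (h + B) 1 0; rewrite addrK !mul1r mul0r subr0.
  rewrite lerBrDl; apply => u u0; rewrite subr0 mul1r; exact: expR_ge1Dx.
apply/eqP; rewrite eq_le; apply/andP; split.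
- have dl := cvg_dnbhs_at_left dc.
  rewrite -/(derive1 _ _) in dl.
  rewrite -(cvg_lim _ dl)//; apply: limr_le; first exact: cvgP dl.
  near=> h; rewrite /= /GRing.scale/= ler_ndivrMl; last by near: h; exact: nbhs_left_lt.
  exact: slope.
- have dr := cvg_dnbhs_at_right dc.
  rewrite -/(derive1 _ _) in dr.
  rewrite -(cvg_lim _ dr)//; apply: limr_ge; first exact: cvgP dr.
  near=> h; rewrite /= /GRing.scale/= ler_pdivlMl; last by near: h; exact: nbhs_right_gt.
  exact: slope.
Unshelve. all: by end_near. Qed.

(** By the critical equation, [mu = (k + 1) / B] is the mean of [u] under the normalised kernel at
    [B]. Jensen gives [F(y) >= exp((y - B) mu) F(B)], and [y / B <= exp(y / B - 1)], raised to the
    power [k + 1], concludes for [y > 0]. *)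
Lemma Fq_max k B y : 0 < B ->
  (k.+1)%:R - B * derive1 (Fq k.+1) B / Fq k.+1 B = 0 ->
  Num.max y 0 ^+ k.+1 <= B ^+ k.+1 / Fq k.+1 B * Fq k.+1 y.
Proof.
move=> B0 /eqP; rewrite subr_eq0 => /eqP hB.
have F0 := Fq_gt0 k.
have d0 : derive1 (Fq k.+1) B != 0.
  apply/eqP => d0; move: hB; rewrite d0 mulr0 mul0r => /eqP.
  by rewrite pnatr_eq0.
have hB' : B * Fq k.+2 B = k.+1%:R * Fq k.+1 B.
  by rewrite hB -(Fq_derive d0) divfK// gt_eqF.
have [y0|y0] := leP y 0.
  by rewrite expr0n/= mulr_ge0 ?divr_ge0 ?exprn_ge0 ?(ltW B0)// ltW.
pose mu : R := k.+1%:R / B.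
have muE : Fq k.+2 B - mu * Fq k.+1 B = 0.
  by rewrite /mu mulrAC -hB' mulrAC divff ?mul1r ?subrr// gt_eqF.
have := @le_Fq_tangent k B y (expR ((y - B) * mu)) mu.
rewrite muE mulr0 addr0 => H.
rewrite mulrAC ler_pdivlMr//.
apply: (@le_trans _ _ (B ^+ k.+1 * (expR ((y - B) * mu) * Fq k.+1 B))); last first.
  rewrite ler_wpM2l ?exprn_ge0 ?(ltW B0)//; apply: H => u u0.
  rewrite (_ : (y - B) * u = (y - B) * mu + (y - B) * (u - mu)); last by ring.
  by rewrite expRD ler_wpM2l ?expR_ge0 ?expR_ge1Dx.
rewrite mulrA ler_wpM2r ?(ltW (F0 _))// /mu.
rewrite (_ : (y - B) * (k.+1%:R / B) = (y / B - 1) * k.+1%:R); last by field; rewrite gt_eqF.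
rewrite expRM_natr -exprMn ler_pXn2r ?nnegrE ?(ltW y0)//; last first.
  by rewrite mulr_ge0 ?expR_ge0 ?(ltW B0).
rewrite -ler_pdivrMl//; apply: le_trans (expR_ge1Dx _).
by rewrite addrC subrK mulrC.
Qed.

End gamma_gauss.

(** * The one-sided stopping problem *)

Lemma bounded_convergence d (Omega : measurableType d) (R : realType) (P : probability Omega R)
  (f_ : nat -> Omega -> R) (f : Omega -> R) (a_ : nat -> R) (a C : R) :
  (forall j, measurable_fun setT (f_ j)) -> (forall j w, `|f_ j w| <= C) ->
  (forall w, f_ j w @[j --> \oo] --> f w) ->
  (forall j, \int[P]_w (f_ j w)%:E = (a_ j)%:E)%E -> a_ j @[j --> \oo] --> a ->
  (\int[P]_w (f w)%:E = a%:E)%E.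
Proof.
move=> mf_ fC f_f fa aa.
have mf : measurable_fun setT f by exact: (measurable_fun_cvg mf_ (fun w _ => f_f w)).
have [_ _ dc] : [/\ P.-integrable setT (fun w => (f w)%:E),
   [sequence \int[P]_w `|(f_ k w)%:E - (f w)%:E|]_k @ \oo --> 0 &
   [sequence \int[P]_w (f_ k w)%:E]_k @ \oo --> \int[P]_w (f w)%:E]%E.
  apply: (@dominated_convergence _ _ _ P _ measurableT _ _ (EFin \o cst C)).
  - by move=> k; apply/measurable_EFinP.
  - by apply/measurable_EFinP.
  - by apply: aeW => w _; apply: cvg_EFin; [exact: nearW|exact: f_f].
  - exact: finite_measure_integrable_cst.
  - by apply: aeW => w k _; rewrite /= lee_fin.
have ac : (a_ j)%:E @[j --> \oo] --> a%:E by apply: cvg_EFin; [exact: nearW|].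
rewrite -(cvg_lim _ dc)// -(cvg_lim _ ac)//; congr (limn _); apply/funext => j.
exact: fa.
Qed.

Lemma measurable_fun_inv_ge0 d (T : measurableType d) (R : realType) (f : T -> R) :
  measurable_fun setT f -> (forall w, 0 <= f w) -> measurable_fun setT (fun w => (f w)^-1).
Proof.
move=> mf f0; have -> : (fun w => (f w)^-1) = (@powR R ^~ (-1)) \o f.
  by apply/funext => w /=; rewrite powR_inv1.
by apply: measurableT_comp => //; exact: measurable_powR.
Qed.

Lemma measurable_fun_sqrt d (T : measurableType d) (R : realType) (f : T -> R) :
  measurable_fun setT f -> measurable_fun setT (fun w => Num.sqrt (f w)).
Proof.
move=> mf; apply: measurableT_comp => //; apply: continuous_measurable_fun.
exact: sqrt_continuous.
Qed.

Section mixture.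
Context {d : measure_display} {Omega : measurableType d} {R : realType}.
Variable P : probability Omega R.

(* The Gaussian-Gamma mixture [F(z/sqrt v)/sqrt v^(k+1)] is the integral of the
   exponential martingales [exp(l z - l^2 v/2)] against [l^k dl]. *)
Lemma Hmix_tonelli k (z v : Omega -> R) : measurable_fun setT z -> measurable_fun setT v ->
  (forall w, 0 < v w) ->
  measurable_fun setT (fun w => Fq k.+1 (z w / Num.sqrt (v w)) / Num.sqrt (v w) ^+ k.+1) /\
  measurable_fun (`[0, +oo[%classic : set (measurableTypeR R))
    (fun l => (l ^+ k)%:E * \int[P]_w (expR (l * z w - l ^+ 2 * v w / 2))%:E)%E /\
  (\int[P]_w (Fq k.+1 (z w / Num.sqrt (v w)) / Num.sqrt (v w) ^+ k.+1)%:E =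
   \int[lebesgue_measure]_(l in `[0%R, +oo[)
     ((l ^+ k)%:E * \int[P]_w (expR (l * z w - l ^+ 2 * v w / 2))%:E))%E.
Proof.
move=> mz mv v0.
pose g (p : Omega * measurableTypeR R) : R := \1_(`[0, +oo[%classic : set R) p.2 *
   (p.2 ^+ k * expR (p.2 * z p.1 - p.2 ^+ 2 * v p.1 / 2)).
have mz1 : measurable_fun setT (fun p : Omega * measurableTypeR R => z p.1).
  by apply: (measurableT_comp mz).
have mv1 : measurable_fun setT (fun p : Omega * measurableTypeR R => v p.1).
  by apply: (measurableT_comp mv).
have m2 : measurable_fun setT (fun p : Omega * measurableTypeR R => p.2 : R).
  exact: measurable_snd.
have mg : measurable_fun setT g.
  have mi : measurable_fun setT (\1_(`[0, +oo[%classic : set R) : measurableTypeR R -> R).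
    exact: measurable_indic.
  apply: measurable_funM; first exact: (measurableT_comp mi m2).
  apply: measurable_funM; first exact: measurable_funX.
  apply: measurableT_comp => //; apply: measurable_funB; first exact: measurable_funM.
  apply: measurable_funM; last exact: measurable_cst.
  by apply: measurable_funM => //; exact: measurable_funX.
have g0 p : 0 <= g p.
  rewrite /g indicE; case: (boolP (_ \in _)) => [|_]; last by rewrite mul0r.
  by rewrite inE /= in_itv/= andbT => p0; rewrite mul1r mulr_ge0 ?exprn_ge0 ?expR_ge0.
have indE (D : set (measurableTypeR R)) (h : R -> \bar R) :
    (\int[lebesgue_measure]_(l in D) h l = \int[lebesgue_measure]_l ((\1_D l)%:E * h l))%E.
  rewrite [LHS]integral_mkcond; apply: eq_integral => l _; rewrite patchE indicE.
  by case: ifPn => _; rewrite ?mul1e ?mul0e.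
have gE w : ((Fq k.+1 (z w / Num.sqrt (v w)) / Num.sqrt (v w) ^+ k.+1)%:E =
    \int[lebesgue_measure]_l (g (w, l))%:E)%E.
  by rewrite -integral_Hmix// indE; exact: eq_integral.
split.
  apply/measurable_EFinP; rewrite (_ : _ \o _ = fun w => \int[lebesgue_measure]_l (g (w, l))%:E)%E.
    apply: (@measurable_fun_fubini_tonelli_F _ _ _ _ _ lebesgue_measure (fun p => (g p)%:E)).
      exact/measurable_EFinP.
    by move=> p; rewrite lee_fin.
  by apply/funext => w; exact: gE.
under eq_integral do rewrite gE.
have mG : measurable_fun setT (fun l => \int[P]_w (g (w, l))%:E)%E.
  apply: (@measurable_fun_fubini_tonelli_G _ _ _ _ _ P (fun p => (g p)%:E)).
    exact/measurable_EFinP.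
  by move=> p; rewrite lee_fin.
have GE l : ((\1_(`[0, +oo[%classic : set R) l)%:E *
    ((l ^+ k)%:E * \int[P]_w (expR (l * z w - l ^+ 2 * v w / 2))%:E) =
    \int[P]_w (g (w, l))%:E)%E.
  rewrite muleA -EFinM -ge0_integralZl//.
  + by apply: eq_integral => w _; exact: (congr1 EFin (esym (mulrA _ _ _))).
  + apply/measurable_EFinP; apply: measurableT_comp => //.
    apply: measurable_funB; first by apply: measurable_funM.
    by apply: measurable_funM => //; apply: measurable_funM.
  + rewrite lee_fin indicE; case: (boolP (_ \in _)) => [|_]; last by rewrite mul0r.
    by rewrite inE /= in_itv/= andbT => p0; rewrite mul1r exprn_ge0.
split.
  apply: (@eq_measurable_fun _ _ _ _ _ (fun l => \int[P]_w (g (w, l))%:E)%E).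
    by move=> l lD; rewrite -GE indicE lD mul1e.
  exact: measurable_funTS.
rewrite (@fubini_tonelli _ _ _ _ _ P lebesgue_measure (fun p => (g p)%:E)).
- by rewrite indE; apply: eq_integral => l _; rewrite GE.
- exact/measurable_EFinP.
- by move=> p; rewrite lee_fin.
Qed.

End mixture.

Section single_stopping.
Context {R : realType}.
Variables (k : nat) (B : R).
Hypothesis B0 : 0 < B.
Hypothesis hB : (k.+1)%:R - B * derive1 (Fq k.+1) B / Fq k.+1 B = 0.

Definition Hmix (v z : R) : R := Fq k.+1 (z / Num.sqrt v) / Num.sqrt v ^+ k.+1.
Definition cB : R := B ^+ k.+1 / Fq k.+1 B.

Lemma cB_ge0 : 0 <= cB.
Proof. by rewrite divr_ge0 ?exprn_ge0 ?(ltW B0)// ltW// Fq_gt0. Qed.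

Lemma Hmix_max v z : 0 < v -> (Num.max z 0 / v) ^+ k.+1 <= cB * Hmix v z.
Proof.
move=> v0; set s := Num.sqrt v; have s0 : 0 < s by rewrite sqrtr_gt0.
have sv : s ^+ 2 = v by rewrite sqr_sqrtr// ltW.
have -> : Num.max z 0 / v = Num.max (z / s) 0 / s.
  rewrite -sv expr2 invfM mulrA; congr (_ / _).
  by rewrite -{2}(mul0r s^-1) maxr_pMl// invr_ge0 ltW.
rewrite expr_div_n /Hmix mulrA ler_wpM2r ?invr_ge0 ?exprn_ge0 ?(ltW s0)//.
exact: Fq_max.
Qed.

Lemma Hmix_boundary v : 0 < v -> cB * Hmix v (B * Num.sqrt v) = (B / Num.sqrt v) ^+ k.+1.
Proof.
move=> v0; have s0 : 0 < Num.sqrt v by rewrite sqrtr_gt0.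
rewrite /Hmix mulfK ?gt_eqF// /cB mulrA divfK ?gt_eqF ?Fq_gt0// expr_div_n//.
Qed.

(** The function U in the coordinates [v = 1 / (1 - t)] and [z = x / (1 - t)], for which
    [z / sqrt v = x / sqrt (1 - t)], and for any exponent [k + 1]. *)
Definition Uk (t x : R) : R :=
  if x < B * Num.sqrt (1 - t) then cB * Hmix (1 - t)^-1 (x / (1 - t)) else x ^+ k.+1.

Context {d : measure_display} {Omega : measurableType d}.
Variable P : probability Omega R.
Variables (t x : R) (t1 : t < 1).

Let v0 : R := (1 - t)^-1.
Let z0 : R := x / (1 - t).

Let v00 : 0 < v0. Proof. by rewrite invr_gt0 subr_gt0. Qed.

(** Shifting the clock by [r = v1 - v0] multiplies each exponential by the deterministic
    [exp(- l^2 r / 2)], so the bound survives integration in [l]. [Hmix_max] then controls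
    [z / (v + r)] instead of [zeta = z / v]; as [v >= v0], the ratio [(v + r) / v] is at most
    [v1 / v0]. *)
Let upper_shift (tau zeta : Omega -> R) (v1 : R) :
  measurable_fun setT tau -> measurable_fun setT zeta ->
  (forall w, t <= tau w < 1) -> v0 <= v1 ->
  (forall l : R, (0 <= l)%R -> \int[P]_w (expR (l * (zeta w / (1 - tau w) - z0)
     - l ^+ 2 / 2 * ((1 - tau w)^-1 - v0)))%:E <= 1)%E ->
  (\int[P]_w (Num.max (zeta w) 0 ^+ k.+1)%:E <= ((v1 / v0) ^+ k.+1 * (cB * Hmix v1 z0))%:E)%E.
Proof.
move=> mtau mzeta tau1 v01 He.
have v10 : 0 < v1 := lt_le_trans v00 v01.
pose v w := (1 - tau w)^-1; pose z w := zeta w / (1 - tau w).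
have mv : measurable_fun setT v.
  apply: measurable_fun_inv_ge0; first exact: measurable_funB.
  by move=> w; rewrite subr_ge0 ltW//; have /andP[] := tau1 w.
have mz : measurable_fun setT z by exact: measurable_funM.
have v0v w : v0 <= v w.
  by have /andP[tw w1] := tau1 w; rewrite lef_pV2 ?posrE ?subr_gt0// lerD2l lerN2.
have vp w : 0 < v w := lt_le_trans v00 (v0v w).
pose r := v1 - v0; have r0 : 0 <= r by rewrite subr_ge0.
have vr w : 0 < v w + r by rewrite ltr_wpDr.
pose q : R := (v1 / v0) ^+ k.+1; have q0 : 0 <= q.
  by rewrite exprn_ge0// divr_ge0// ltW.
have mvr : measurable_fun setT (fun w => v w + r) by exact: measurable_funD.
have [mH [mI HE]] := Hmix_tonelli P k mz mvr vr.
have zv w : zeta w = z w / v w.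
  rewrite /z /v invrK divfK// gt_eqF// subr_gt0.
  by have /andP[] := tau1 w.
have qv w : ((v w + r) / v w) ^+ k.+1 <= q.
  have rv0 := ltW (vp w).
  rewrite ler_pXn2r ?nnegrE ?divr_ge0 ?(ltW (vr w)) ?(ltW v10) ?(ltW v00)//.
  rewrite ler_pdivrMr// mulrAC ler_pdivlMr// /r mulrDl mulrBl.
  have := ler_wpM2l r0 (v0v w); rewrite /r; nra.
have le1 w : Num.max (zeta w) 0 ^+ k.+1 <= q * (cB * Hmix (v w + r) (z w)).
  have -> : Num.max (zeta w) 0 = Num.max (z w) 0 / (v w + r) * ((v w + r) / v w).
    rewrite mulrA divfK ?gt_eqF// zv -{1}(mul0r (v w)^-1) maxr_pMl// invr_ge0.
    exact: ltW.
  rewrite exprMn mulrC ler_pM ?exprn_ge0 ?divr_ge0 ?(ltW (vp w)) ?(ltW (vr w))//.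
    by rewrite le_max lexx orbT.
  exact: Hmix_max.
apply: (@le_trans _ _ (\int[P]_w ((q * cB)%:E * (Hmix (v w + r) (z w))%:E))%E).
  apply: ge0_le_integral => //.
  - by move=> w _; rewrite lee_fin exprn_ge0// le_max lexx orbT.
  - by apply/measurable_EFinP; apply: measurable_funX; exact: measurable_maxr.
  - by apply/measurable_EFinP; apply: measurable_funM.
  - by move=> w _; rewrite -EFinM lee_fin -mulrA.
rewrite ge0_integralZl//; last 3 first.
- exact/measurable_EFinP.
- by move=> w _; rewrite lee_fin divr_ge0 ?exprn_ge0 ?sqrtr_ge0// ltW// Fq_gt0.
- by rewrite lee_fin mulr_ge0 ?cB_ge0.
rewrite HE mulrA [leRHS]EFinM; apply: lee_wpmul2l.
  by rewrite lee_fin mulr_ge0 ?cB_ge0.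
rewrite -integral_Hmix//; apply: ge0_le_integral => //.
- move=> l; rewrite /= in_itv/= andbT => l0; apply: mule_ge0.
    by rewrite lee_fin exprn_ge0.
  by apply: integral_ge0 => w _; rewrite lee_fin expR_ge0.
- apply/measurable_EFinP; apply: measurable_funTS.
  apply: measurable_funM; first exact: measurable_funX.
  apply: measurableT_comp => //; apply: measurable_funB; first by apply: measurable_funM.
  by apply: measurable_funM => //; apply: measurable_funM => //; exact: measurable_funX.
move=> l; rewrite /= in_itv/= andbT => l0; rewrite EFinM; apply: lee_wpmul2l.
  by rewrite lee_fin exprn_ge0.
have := He l l0; move/(lee_wpmul2l (x := (expR (l * z0 - l ^+ 2 * v1 / 2))%:E)).
rewrite lee_fin expR_ge0 mule1 => /(_ isT); apply: le_trans.
rewrite -ge0_integralZl//.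
- rewrite le_eqVlt; apply/orP; left; apply/eqP; apply: eq_integral => w _.
  rewrite -EFinM -expRD; congr (expR _)%:E; rewrite /z /v /r; field.
  by rewrite gt_eqF// subr_gt0; have /andP[] := tau1 w.
- apply/measurable_EFinP; apply: measurableT_comp => //; apply: measurable_funB.
    by apply: measurable_funM => //; exact: measurable_funB.
  by apply: measurable_funM => //; exact: measurable_funB.
Qed.

Let s0 : R := Num.sqrt (1 - t).
Let s00 : 0 < s0. Proof. by rewrite sqrtr_gt0 subr_gt0. Qed.
Let s02 : 1 - t = s0 ^+ 2. Proof. by rewrite sqr_sqrtr// subr_ge0 ltW. Qed.

(* If [x] lies beyond the boundary, the clock [v] is shifted by [v1 - v0] with
   [v1 = (z0/B)^2], which puts the starting point exactly on the boundary; the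
   shift costs at most the factor [(v1/v0)^(k+1)] attained at time [t]. *)
Lemma single_upper (tau zeta : Omega -> R) :
  measurable_fun setT tau -> measurable_fun setT zeta ->
  (forall w, t <= tau w < 1) ->
  (forall l : R, (0 <= l)%R -> \int[P]_w (expR (l * (zeta w / (1 - tau w) - x / (1 - t))
     - l ^+ 2 / 2 * ((1 - tau w)^-1 - (1 - t)^-1)))%:E <= 1)%E ->
  (\int[P]_w (Num.max (zeta w) 0 ^+ k.+1)%:E <= (Uk t x)%:E)%E.
Proof.
move=> mtau mzeta tau1 He; rewrite /Uk; case: ltP => [_|Bx].
  have := upper_shift mtau mzeta tau1 (lexx v0) He.
  by rewrite divff ?gt_eqF// expr1n mul1r.
have x0 : 0 < x by rewrite (lt_le_trans _ Bx)// mulr_gt0.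
have z0E : z0 = x / s0 ^+ 2 by rewrite /z0 s02.
have v0E : v0 = (s0 ^+ 2)^-1 by rewrite /v0 s02.
have zp : 0 < z0 by rewrite /z0 divr_gt0// subr_gt0.
have v1E : Num.sqrt ((z0 / B) ^+ 2) = z0 / B by rewrite sqrtr_sqr gtr0_norm//; exact: divr_gt0.
have v01 : v0 <= (z0 / B) ^+ 2.
  rewrite v0E -exprVn ler_pXn2r ?nnegrE ?invr_ge0 ?(ltW s00) ?(ltW (divr_gt0 zp B0))//.
  rewrite ler_pdivlMr// z0E expr2 invfM mulrA ler_pdivlMr// mulrAC mulVf ?gt_eqF// mul1r.
  by rewrite ler_pdivlMr.
have := upper_shift mtau mzeta tau1 v01 He.
have zB : z0 = B * Num.sqrt ((z0 / B) ^+ 2) by rewrite v1E mulrC divfK// gt_eqF.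
have -> : cB * Hmix ((z0 / B) ^+ 2) z0 = (B / (z0 / B)) ^+ k.+1.
  by rewrite [in X in Hmix _ X]zB Hmix_boundary ?v1E// exprn_gt0// divr_gt0.
rewrite -exprMn (_ : _ / v0 * _ = x)//.
rewrite v0E z0E invrK; field.
by rewrite !gt_eqF.
Qed.

Let T (j : nat) : R := 1 - (1 - t) / (2 ^ j)%:R.

Lemma horizon_itv j : t <= T j < 1.
Proof.
rewrite /T ltrBlDr ltrDl divr_gt0 ?pow2_gt0 ?subr_gt0// andbT.
rewrite lerBrDr -lerBrDl ler_pdivrMr ?pow2_gt0// ler_peMr ?subr_ge0 ?(ltW t1)//.
by rewrite ler1n expn_gt0.
Qed.

Lemma cvg_horizon : T j @[j --> \oo] --> (1 : R).
Proof. by rewrite -[X in _ --> X]subr0; apply: cvgB; [exact: cvg_cst|exact: cvg_mesh]. Qed.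

(** * Attainment at a hitting time that may a priori equal 1 *)

Section attained.
Variables (sigma : Omega -> R) (zeta : nat -> Omega -> R).
Hypothesis xB : x < B * s0.
Hypothesis msigma : measurable_fun setT sigma.
Hypothesis mzeta : forall j, measurable_fun setT (zeta j).
Hypothesis sigma1 : forall w, t <= sigma w <= 1.
Hypothesis zeta_le : forall j w, zeta j w <= B * Num.sqrt (1 - clip t (T j) (sigma w)).
Hypothesis zeta_eq : forall j w, sigma w <= T j -> zeta j w = B * Num.sqrt (1 - sigma w).
Hypothesis He : forall j l, (\int[P]_w (expR (l * (zeta j w / (1 - clip t (T j) (sigma w)) - z0)
     - l ^+ 2 / 2 * ((1 - clip t (T j) (sigma w))^-1 - v0)))%:E = 1)%E.

Let early := [set w | sigma w < 1].

Let m_early : measurable early.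
Proof.
rewrite (_ : early = sigma @^-1` `]-oo, 1[%classic).
  by rewrite -[X in measurable X]setTI; exact: msigma.
by apply/seteqP; split => w /=; rewrite in_itv.
Qed.

(** For [l > 0], the limit of the stopped exponentials along the horizons; where [sigma = 1] the
    exploding clock sends them to zero. *)
Let e l w : R := \1_early w * expR (l * (B * Num.sqrt (1 - sigma w) / (1 - sigma w) - z0)
   - l ^+ 2 / 2 * ((1 - sigma w)^-1 - v0)).

Let sqrt_ratio (u : R) : u < 1 -> Num.sqrt (1 - u) / (1 - u) = (Num.sqrt (1 - u))^-1.
Proof.
move=> u1; have h : 0 < Num.sqrt (1 - u) by rewrite sqrtr_gt0 subr_gt0.
rewrite -{2}(@sqr_sqrtr _ (1 - u)) ?subr_ge0 ?ltW// expr2 invfM mulrA divff ?mul1r//.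
by rewrite gt_eqF.
Qed.

(** From [(B - l q / 2)^2 >= 0]: the boundary term [l B q] is absorbed by [B^2] and half of the
    clock term. The other half, [- l^2 q^2 / 4], remains; it yields a bound free of [q] and decay as
    [q] grows. *)
Let expo_le (a l q : R) : 0 < l -> a <= B * q ->
  l * (a - z0) - l ^+ 2 / 2 * (q ^+ 2 - v0) <= B ^+ 2 - l * z0 + l ^+ 2 / 2 * v0 - l ^+ 2 / 4 * q ^+ 2.
Proof.
move=> l0 aq; have := ler_wpM2l (ltW l0) aq.
have := sqr_ge0 (B - l * q / 2); rewrite !expr2; lra.
Qed.

Let integral_e l : 0 < l -> (\int[P]_w (e l w)%:E = 1)%E.
Proof.
move=> l0.
pose tau j w := clip t (T j) (sigma w).
pose C := B ^+ 2 - l * z0 + l ^+ 2 / 2 * v0.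
have tauT j w : tau j w <= T j.
  by have /andP[tT _] := horizon_itv j; have /andP[_] := clip_itv (sigma w) tT.
have tau_lt1 j w : tau j w < 1 by have /andP[_] := horizon_itv j; exact: le_lt_trans.
have bound j w : l * (zeta j w / (1 - tau j w) - z0) - l ^+ 2 / 2 * ((1 - tau j w)^-1 - v0)
    <= C - l ^+ 2 / 4 * (1 - tau j w)^-1.
  have h : 0 < 1 - tau j w by rewrite subr_gt0.
  have qE : (Num.sqrt (1 - tau j w))^-1 ^+ 2 = (1 - tau j w)^-1.
    by rewrite exprVn sqr_sqrtr// ltW.
  have aq : zeta j w / (1 - tau j w) <= B * (Num.sqrt (1 - tau j w))^-1.
    by rewrite -sqrt_ratio// mulrA ler_wpM2r ?invr_ge0 ?(ltW h).
  by have := expo_le l0 aq; rewrite qE.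
have l2 : 0 < l ^+ 2 / 4 by rewrite divr_gt0 ?exprn_gt0.
apply: (@bounded_convergence _ _ _ P (fun j w => expR (l * (zeta j w / (1 - tau j w) - z0)
     - l ^+ 2 / 2 * ((1 - tau j w)^-1 - v0))) (e l) (fun=> 1) 1 (expR C)).
- move=> j; have mt : measurable_fun setT (fun w => 1 - tau j w).
    by apply: measurable_funB => //; apply: measurable_maxr => //; exact: measurable_minr.
  have mi : measurable_fun setT (fun w => (1 - tau j w)^-1).
    by apply: measurable_fun_inv_ge0 => // w; rewrite subr_ge0 ltW.
  apply: measurableT_comp => //; apply: measurable_funB; apply: measurable_funM => //.
    by apply: measurable_funB => //; exact: measurable_funM.
  exact: measurable_funB.
- move=> j w; rewrite ger0_norm ?expR_ge0// ler_expR (le_trans (bound j w))// gerBl.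
  by rewrite mulr_ge0 ?(ltW l2)// invr_ge0 subr_ge0 ltW.
- move=> w; have [w1|w1] := ltP (sigma w) 1.
    apply: cvg_near_cst; rewrite /e indicE mem_set// mul1r.
    near=> j; have sT : sigma w < T j by near: j; exact: (cvgr_gt _ cvg_horizon _ w1).
    have sE : tau j w = sigma w.
      by rewrite /tau clip_id// (ltW sT) andbT; have /andP[] := sigma1 w.
    by rewrite sE zeta_eq// ltW.
  rewrite /e indicE memNset ?mul0r; last by rewrite /early/= ltNge w1.
  have sw : sigma w = 1 by apply/eqP; rewrite eq_le w1 andbT; have /andP[] := sigma1 w.
  (* Here the stopped time is [T j] itself, and [exp(- y) <= 1 / y] is used with
     [y = l^2 / 4 * 2^j / (1 - t)]. *)
  apply: (@squeeze_cvgr _ _ _ _ (fun=> 0) (fun j => (expR C * (4 * (1 - t) / l ^+ 2)) / (2 ^ j)%:R)).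
  + apply: nearW => j; rewrite expR_ge0/=.
    have -> : tau j w = T j.
      have /andP[tT T1] := horizon_itv j.
      by rewrite /tau /clip sw min_r ?(ltW T1)// max_r.
    have y0 : 0 < l ^+ 2 / 4 * ((2 ^ j)%:R / (1 - t)).
      by rewrite mulr_gt0// divr_gt0 ?pow2_gt0// subr_gt0.
    have TE : (1 - T j)^-1 = (2 ^ j)%:R / (1 - t).
      by rewrite /T opprB addrC subrK invf_div.
    have := bound j w; rewrite (_ : tau j w = T j); last first.
      have /andP[tT T1] := horizon_itv j.
      by rewrite /tau /clip sw min_r ?(ltW T1)// max_r.
    rewrite TE -ler_expR => /le_trans; apply.
    rewrite expRD -[leRHS]mulrA ler_wpM2l ?expR_ge0// expRN.
    have -> : 4 * (1 - t) / l ^+ 2 / (2 ^ j)%:R = (l ^+ 2 / 4 * ((2 ^ j)%:R / (1 - t)))^-1.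
      by field; rewrite !gt_eqF ?pow2_gt0// subr_gt0.
    rewrite lef_pV2 ?posrE ?expR_gt0//; apply: le_trans (expR_ge1Dx _).
    by rewrite lerDr.
  + exact: cvg_cst.
  + exact: cvg_mesh.
- by move=> j; exact: He.
- exact: cvg_cst.
Unshelve. all: by end_near. Qed.

Let measurable_e l : measurable_fun setT (e l).
Proof.
have mt : measurable_fun setT (fun w => 1 - sigma w) by exact: measurable_funB.
have mi : measurable_fun setT (fun w => (1 - sigma w)^-1).
  by apply: measurable_fun_inv_ge0 => // w; rewrite subr_ge0; have /andP[] := sigma1 w.
have ms : measurable_fun setT (fun w => B * Num.sqrt (1 - sigma w)).
  by apply: measurable_funM => //; exact: measurable_fun_sqrt.
apply: measurable_funM; first exact: measurable_indic.
apply: measurableT_comp => //; apply: measurable_funB; apply: measurable_funM => //.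
  by apply: measurable_funB => //; exact: measurable_funM.
exact: measurable_funB.
Qed.

Let e_ge0 l w : 0 <= e l w.
Proof. by rewrite /e mulr_ge0 ?expR_ge0. Qed.

Lemma attained_early : P early = 1%E.
Proof.
rewrite -[LHS](_ : (\int[P]_w (\1_early w)%:E)%E = _); last by rewrite integral_indic// setIT.
(* The dominating constant bounds the right side of [expo_le] for all [0 < l <= 1], a range that
   contains every [harmonic j]. *)
apply: (@bounded_convergence _ _ _ P (fun j => e (harmonic j)) _ (fun=> 1) 1
  (expR (B ^+ 2 + `|z0| + v0))).
- by move=> j; exact: measurable_e.
- move=> j w; rewrite ger0_norm// /e indicE.
  have [|_] := boolP (w \in early); last by rewrite mul0r expR_ge0.
  rewrite inE => w1; rewrite mul1r ler_expR.
  set l : R := harmonic j.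
  have l0 : 0 < l by exact: harmonic_gt0.
  have l1 : l <= 1 by rewrite /l /harmonic/= invf_le1// ler1n.
  have h : 0 < 1 - sigma w by rewrite subr_gt0.
  have qE : (Num.sqrt (1 - sigma w))^-1 ^+ 2 = (1 - sigma w)^-1.
    by rewrite exprVn sqr_sqrtr// ltW.
  have aq : B * Num.sqrt (1 - sigma w) / (1 - sigma w) <= B * (Num.sqrt (1 - sigma w))^-1.
    by rewrite -sqrt_ratio// mulrA.
  have := expo_le l0 aq; rewrite qE => /le_trans; apply.
  have l21 : l ^+ 2 <= 1 by rewrite expr_le1// ltW.
  have h1 : - (l * z0) <= `|z0|.
    rewrite (le_trans (ler_norm _))// normrN normrM ger0_norm ?(ltW l0)//.
    by rewrite ler_piMl.
  have h2 : l ^+ 2 / 2 * v0 <= v0.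
    by rewrite ler_piMl ?(ltW v00)// ler_pdivrMr// mul1r (le_trans l21)// ler1n.
  have h3 : 0 <= l ^+ 2 / 4 * (1 - sigma w)^-1.
    by rewrite mulr_ge0 ?invr_ge0 ?(ltW h)// divr_ge0 ?sqr_ge0.
  rewrite lerBlDr -[leLHS]addr0; apply: lerD => //; apply: lerD => //.
  by rewrite lerD2l.
- move=> w; have hc : (harmonic j : R) @[j --> \oo] --> 0 by exact: cvg_harmonic.
  have -> : \1_early w = \1_early w * expR (0 * (B * Num.sqrt (1 - sigma w) / (1 - sigma w) - z0)
       - 0 ^+ 2 / 2 * ((1 - sigma w)^-1 - v0)) :> R.
    by rewrite expr0n/= !mul0r subrr expR0 mulr1.
  apply: cvgMr; apply: continuous_cvg; first exact: continuous_expR.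
  apply: cvgB; apply: cvgMl; first exact: hc.
  by apply: cvgMl; rewrite expr2; under eq_fun do rewrite expr2; apply: cvgM; exact: hc.
- by move=> j; apply: integral_e; exact: harmonic_gt0.
- exact: cvg_cst.
Qed.

Lemma attained_value : (\int[P]_w ((B * Num.sqrt (1 - sigma w)) ^+ k.+1)%:E = (Uk t x)%:E)%E.
Proof.
(* Where [sigma = 1] the inverse is [0] by convention. The indicator makes the clock positive
   everywhere, as [Hmix_tonelli] requires, and alters it only on a null set. *)
pose v w := (1 - sigma w)^-1 + \1_(~` early) w.
have mt : measurable_fun setT (fun w => 1 - sigma w) by exact: measurable_funB.
have mi : measurable_fun setT (fun w => (1 - sigma w)^-1).
  by apply: measurable_fun_inv_ge0 => // w; rewrite subr_ge0; have /andP[] := sigma1 w.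
have mv : measurable_fun setT v.
  by apply: measurable_funD => //; apply: measurable_indic; exact: measurableC.
have vE w : early w -> v w = (1 - sigma w)^-1.
  by move=> ew; rewrite /v indicE memNset ?addr0//=; exact.
have vp w : 0 < v w.
  have [ew|ew] := pselect (early w); first by rewrite vE// invr_gt0 subr_gt0.
  rewrite /v indicE mem_set// ltr_wpDl// invr_ge0 subr_ge0.
  by have /andP[] := sigma1 w.
have mz : measurable_fun setT (fun w => B * Num.sqrt (v w)).
  by apply: measurable_funM => //; exact: measurable_fun_sqrt.
have [mH [mI HE]] := Hmix_tonelli P k mz mv vp.
have ae_early : {ae P, forall w, early w}.
  exists (~` early); split => //; first exact: measurableC.
  by rewrite probability_setC// attained_early subee.
transitivity (\int[P]_w (cB%:E * (Hmix (v w) (B * Num.sqrt (v w)))%:E))%E.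
  apply: ae_eq_integral => //.
  - apply/measurable_EFinP; apply: measurable_funX; apply: measurable_funM => //.
    exact: measurable_fun_sqrt.
  - by apply/measurable_EFinP; apply: measurable_funM.
  - apply: filterS ae_early => w ew _; rewrite -EFinM Hmix_boundary// vE//.
    by rewrite sqrtrV ?subr_ge0 ?(ltW ew)// invrK.
rewrite ge0_integralZl//; last 3 first.
- exact/measurable_EFinP.
- by move=> w _; rewrite lee_fin divr_ge0 ?exprn_ge0 ?sqrtr_ge0// ltW// Fq_gt0.
- by rewrite lee_fin cB_ge0.
rewrite HE /Uk ifT; last exact: xB.
rewrite [RHS]EFinM /Hmix -integral_Hmix; last exact: v00.
congr (_ * _)%E.
apply: eq_integral => l; rewrite inE/= in_itv/= andbT => l0.
rewrite [RHS]EFinM; congr (_ * _)%E.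
(* [integral_e] covers [l > 0]; at [l = 0] both exponentials equal one. *)
move: l0; rewrite le_eqVlt => /predU1P[<-|l0].
  under eq_integral do rewrite mul0r expr0n/= !mul0r subrr expR0.
  rewrite mul0r expr0n/= !mul0r subrr expR0.
  by rewrite integral_cst// mul1e; exact: probability_setT.
transitivity (\int[P]_w ((expR (l * z0 - l ^+ 2 * v0 / 2))%:E * (e l w)%:E))%E.
  apply: ae_eq_integral => //.
  - apply/measurable_EFinP; apply: measurableT_comp => //; apply: measurable_funB.
      exact: measurable_funM.
    by apply: measurable_funM => //; exact: measurable_funM.
  - by apply/measurable_EFinP; apply: measurable_funM.
  - apply: filterS ae_early => w ew _; rewrite -EFinM /e indicE mem_set// mul1r -expRD.
    congr (expR _)%:E; rewrite vE// sqrtrV ?subr_ge0 ?(ltW ew)// -sqrt_ratio//.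
    by field; rewrite gt_eqF// subr_gt0.
rewrite ge0_integralZl//.
- by rewrite integral_e// mule1.
- exact/measurable_EFinP.
- by move=> w _; rewrite lee_fin.
Qed.

End attained.
End single_stopping.

(** * Hitting times *)

Section ae_integral.
Context d (Omega : measurableType d) (R : realType) (mu : {measure set Omega -> \bar R}).
Local Open Scope ereal_scope.
Import HBNNSimple.

(* The integral of an arbitrary nonnegative function is, by definition, the
   supremum over the simple functions below it. *)
Lemma ae_le_integral_nonneg (f g : Omega -> \bar R) :
  (forall w, 0 <= f w) -> (forall w, 0 <= g w) -> measurable_fun setT g ->
  {ae mu, forall w, f w <= g w} -> \int[mu]_w f w <= \int[mu]_w g w.
Proof.
move=> f0 g0 mg fg; rewrite (ge0_integralTE _ f0); apply: ge_ereal_sup => _ [h /= hf <-].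
rewrite -integralT_nnsfun; apply: ae_ge0_le_integral => //.
- by move=> w _; rewrite lee_fin.
- exact/measurable_EFinP.
- by apply: filterS fg => w fgw _; exact: le_trans fgw.
Qed.

Lemma ae_eq_integral_nonneg (f g : Omega -> \bar R) :
  (forall w, 0 <= f w) -> (forall w, 0 <= g w) -> measurable_fun setT g ->
  {ae mu, forall w, f w = g w} -> \int[mu]_w f w = \int[mu]_w g w.
Proof.
move=> f0 g0 mg fg; apply/eqP; rewrite eq_le; apply/andP; split.
  by apply: ae_le_integral_nonneg => //; apply: filterS fg => w ->.
have [N [mN N0 subN]] := fg.
have mg' : measurable_fun setT (g \_ (~` N)).
  by apply/(measurable_restrictT _ _).1; [exact: measurableC|exact: measurable_funTS].
(* Once [g] is cut to zero on the null set [N], every simple function below it is also below [f],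
   which agrees with [g] off [N] and is nonnegative on it. *)
have -> : \int[mu]_w g w = \int[mu]_w (g \_ (~` N)) w.
  apply: ae_eq_integral => //.
  exists N; split => // w /= h; apply: contrapT => Nw; apply: h => _.
  by rewrite patchE mem_set.
rewrite (ge0_integralTE _ f0) ge0_integralTE; last first.
  by move=> w; rewrite patchE; case: ifPn.
apply: le_ereal_sup => _ [h /= hg <-]; exists h => // w.
apply: (le_trans (hg w)); rewrite patchE; case: ifPn => [/set_mem wN|_]; last exact: f0.
by rewrite -[leRHS](_ : g w = _)//; apply: contrapT => h'; apply: wN; apply: subN => /= fgw; apply: h'.
Qed.

(** Meant for the payoff of an arbitrary admissible pair as [f]. Dropping the negative part only
    increases the integral and leaves two nonnegative functions. *)
Lemma ae_le_integral (f g : Omega -> \bar R) :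
  (forall w, 0 <= g w) -> measurable_fun setT g ->
  {ae mu, forall w, f w <= g w} -> \int[mu]_w f w <= \int[mu]_w g w.
Proof.
move=> g0 mg fg; rewrite integralE; apply: (@le_trans _ _ (\int[mu]_w f^\+ w)).
  by rewrite -[leRHS]sube0; apply: leeB => //; apply: integral_ge0.
apply: ae_le_integral_nonneg => //.
apply: filterS fg => w fgw; by rewrite funeposE ge_max fgw g0.
Qed.
Lemma ae_eq_integral_ge0 (f g : Omega -> \bar R) :
  (forall w, 0 <= g w) -> measurable_fun setT g ->
  {ae mu, forall w, f w = g w} -> \int[mu]_w f w = \int[mu]_w g w.
Proof.
move=> g0 mg fg; rewrite integralE (ae_eq_integral_nonneg _ g0 mg) //; last first.
  by apply: filterS fg => w fgw; rewrite funeposE fgw max_l.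
rewrite (@ae_eq_integral_nonneg f^\- (cst 0))//; last first.
  by apply: filterS fg => w fgw; rewrite funenegE fgw max_r// oppe_le0.
by rewrite integral0 sube0.
Qed.
End ae_integral.

(** * First hitting of a continuous boundary by a continuous path *)

Section hitting.
Context {R : realType}.
Variables (a : R) (a1 : a < 1).

Lemma hit_le1 (r : R) (C : R -> Prop) : r <= 1 -> r <= hit r C <= 1.
Proof.
move=> r1; rewrite /hit; case: asboolP => [[s [/andP[rs s1] Cs]]|_]; last by rewrite r1 lexx.
have Ss : [set s | r <= s < 1 /\ C s] s by split => //; rewrite rs s1.
have lb : lbound [set s | r <= s < 1 /\ C s] r by move=> u [/andP[]].
apply/andP; split; first by apply: lb_le_inf => //; exists s.
by rewrite (le_trans _ (ltW s1))//; apply: ge_inf => //; exists r.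
Qed.

Lemma hit_le (C : R -> Prop) s : a <= s < 1 -> C s -> hit a C <= s.
Proof.
move=> s1 Cs; rewrite /hit asboolT; last by exists s.
by apply: ge_inf => //; exists a => u [/andP[]].
Qed.

Lemma hit_ge (C : R -> Prop) m : m <= 1 ->
  (forall s, a <= s < 1 -> C s -> m <= s) -> m <= hit a C.
Proof.
move=> m1 H; rewrite /hit; case: asboolP => [[s [s1 Cs]]|//].
by apply: lb_le_inf; [exists s|move=> u [u1 Cu]; exact: H].
Qed.

(** This turns the second stage of [tau2star], which starts at [tau1star], into a hitting time
    counted from [t]. *)
Lemma hit_shift (C : R -> Prop) r : a <= r -> r <= hit a C -> hit r C = hit a C.
Proof.
move=> ar rh; have E : (fun s => r <= s < 1 /\ C s) = (fun s => a <= s < 1 /\ C s).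
  apply/funext => s; apply/propext; split => [[/andP[rs s1] Cs]|[s1 Cs]].
    by rewrite (le_trans ar rs) s1.
  by split => //; rewrite (le_trans rh (hit_le s1 Cs)); case/andP: s1.
by rewrite /hit E.
Qed.

Variables (y beta : R -> R).
Hypothesis yc : {within `[a, 1[, continuous y}.
Hypothesis bc : {within `[a, 1[, continuous beta}.
Let C s := beta s <= y s.

Let hc : {within `[a, 1[, continuous (fun s => y s - beta s)}.
Proof.
by move=> s; apply: cvgB; [exact: yc|exact: bc].
Qed.

(** Were the path strictly below the boundary at the infimum [r], continuity would keep it there on
    [[r, r + q)], and the infimum would be at least [r + q], or at least 1 if [r + q] exceeds 1. *)
Lemma hit_attained : hit a C < 1 -> C (hit a C).
Proof.
move=> h1; have /andP[ah _] := hit_le1 C (ltW a1).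
set r := hit a C in h1 ah *.
rewrite /C leNgt; apply/negP => lt.
have e0 : 0 < beta r - y r by rewrite subr_gt0.
have rA : `[a, 1[%classic r by rewrite /= in_itv/= ah h1.
have [q q0 H] := within_continuousP hc rA e0.
have : r + q <= r; last by rewrite gerDl leNgt q0.
have [rq|rq] := leP (r + q) 1; last first.
  have : 1 <= r; last by rewrite leNgt h1.
  apply: hit_ge => // s /[dup] s1 /andP[as' s1'] Cs.
  have rs := @hit_le C s s1 Cs; rewrite -/r in rs.
  have sA : `[a, 1[%classic s by rewrite /= in_itv/= as' s1'.
  have := H s sA; rewrite distrC ger0_norm ?subr_ge0// ltrBlDl => /(_ (lt_trans s1' rq)).
  rewrite ltr_norml => /andP[+ _]; move: Cs; rewrite /C; lra.
apply: hit_ge => // s /[dup] s1 /andP[as' s1'] Cs; rewrite leNgt; apply/negP => srq.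
have rs := @hit_le C s s1 Cs; rewrite -/r in rs.
have sA : `[a, 1[%classic s by rewrite /= in_itv/= as' s1'.
have := H s sA; rewrite distrC ger0_norm ?subr_ge0// ltrBlDl => /(_ srq).
rewrite ltr_norml => /andP[+ _]; move: Cs; rewrite /C; lra.
Qed.

(** A hit by time [s] means that the maximum of [y - beta] over [[a, s]] is nonnegative. Dyadic
    points and the slack [1 / (k + 1)] make this a countable condition, from which the stopping time
    property follows. *)
Lemma hit_le_grid s : a <= s -> s < 1 ->
  (hit a C <= s) <-> (forall k : nat, exists N, exists2 j, (j <= 2 ^ N)%N &
     beta (grid a s N j) - (k.+1%:R)^-1 < y (grid a s N j)).
Proof.
move=> as' s1.
have hcs : {within `[a, s], continuous (fun s => y s - beta s)}.
  by apply: continuous_subspaceW hc; apply: subset_itv; rewrite bnd_simp.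
split => [hs k|H].
  have h1 := le_lt_trans hs s1; have /andP[ah _] := hit_le1 C (ltW a1).
  have Ch := hit_attained h1.
  set r := hit a C in hs h1 ah Ch *.
  have rA : `[a, s]%classic r by rewrite /= in_itv/= ah hs.
  have gA N : `[a, s]%classic (grid a s N (gidx a s N r)).
    by rewrite /= in_itv/=; apply: grid_itv => //; exact: gidx_le.
  have gr : grid a s N (gidx a s N r) @[N --> \oo] --> r.
    by rewrite -[X in _ --> X](@clip_id R a s r) ?ah ?hs//; exact: cvg_grid_gidx.
  have := within_cvg_seq hcs rA gA gr.
  have k0 : - (k.+1%:R)^-1 < y r - beta r.
    by rewrite (@lt_le_trans _ _ 0) ?subr_ge0// oppr_lt0 invr_gt0.
  move=> /cvgr_gt/(_ _ k0) [N _ /(_ N (leqnn N))/= HN].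
  exists N, (gidx a s N r); first exact: gidx_le.
  by move: HN; rewrite ltrBrDl.
have [c cs cmax] := EVT_max as' hcs.
rewrite in_itv/= in cs; have /andP[ac cs'] := cs.
rewrite (le_trans _ cs')//; apply: (@hit_le C); first by rewrite ac (le_lt_trans cs').
rewrite /C leNgt; apply/negP => lt.
have e0 : 0 < beta c - y c by rewrite subr_gt0.
have [k _ /(_ k (leqnn k))/= Hk] : \forall k \near \oo, (k.+1%:R)^-1 < beta c - y c :> R.
  exact: near_infty_natSinv_lt (PosNum e0).
have [N [j jN Hj]] := H k.
have := cmax (grid a s N j); rewrite in_itv/= grid_itv// => /(_ isT).
move: Hk Hj; set q : R := (k.+1%:R)^-1; move: q => q; lra.
Qed.

End hitting.

(** * The switching problem *)

Section value_functions.
Context {R : realType}.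
Variables (n : nat) (B : R).
Hypothesis B0 : 0 < B.

Lemma Ufun_Uk t x : t < 1 -> Ufun n B t x = Uk (2 * n) B t x.
Proof.
move=> t1; rewrite /Ufun /Uk !addn1; case: ifP => // _.
set s := Num.sqrt (1 - t).
have s0 : 0 < s by rewrite sqrtr_gt0 subr_gt0.
have sE : 1 - t = s ^+ 2 by rewrite sqr_sqrtr// subr_ge0 ltW.
have -> : (1 - t) `^ (n%:R + 2^-1) = s ^+ (2 * n).+1.
  rewrite powRD ?powR_mulrn ?subr_ge0 ?(ltW t1)//; last first.
    by apply/implyP => _; rewrite gt_eqF// subr_gt0.
  by rewrite powR12_sqrt ?subr_ge0 ?(ltW t1)// -/s sE -exprM -exprSr.
rewrite /cB /Hmix sE.
have -> : Num.sqrt (s ^+ 2)^-1 = s^-1.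
  by rewrite sqrtrV ?exprn_ge0 ?(ltW s0)// sqrtr_sqr gtr0_norm.
have -> : x / s ^+ 2 / s^-1 = x / s by field; rewrite gt_eqF.
by rewrite exprVn invrK; ring.
Qed.

(** Inside the strip both terms are given by F, at arguments of opposite sign. Outside it one term
    is a bare power, and oddness of the exponent turns the sum into [gfun]. *)
Lemma Jstar_Uk t x : t < 1 -> Jstar n B t x = Uk (2 * n) B t x + Uk (2 * n) B t (- x).
Proof.
move=> t1; have s0 : 0 < Num.sqrt (1 - t) by rewrite sqrtr_gt0 subr_gt0.
have Bs0 : 0 < B * Num.sqrt (1 - t) by rewrite mulr_gt0.
have odd_opp (y : R) : (- y) ^+ (2 * n + 1) = - y ^+ (2 * n + 1).
  by rewrite exprNn exprD exprM sqrrN expr1n expr1n mul1r expr1 mulN1r.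
rewrite -!Ufun_Uk// /Jstar; case: ifPn => [|].
  rewrite ltr_norml => /andP[xl xr].
  rewrite /Ufun xr ltrNl xl /jfun /Gq !addn1 mulNr.
  have FB := Fq_gt0 (2 * n) B; have FN := Fq_gt0 (2 * n) (- B).
  set F1 := Fq _ (x / _); set F2 := Fq _ (- (x / _)).
  field; rewrite !gt_eqF ?addr_gt0//.
rewrite -leNgt /gfun => Bx; case: ltP => [x0|x0].
  rewrite gtr0_norm// in Bx.
  by rewrite [Ufun n B t x]/Ufun ltNge Bx/= addrC.
rewrite ler0_norm// in Bx.
by rewrite [Ufun n B t (- x)]/Ufun ltNge Bx/= odd_opp.
Qed.

End value_functions.

Section optimal_switching.
Context {R : realType}.
Variables (n : nat) (B : R).
Hypothesis B0 : 0 < B.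
Hypothesis hB : (2 * n + 1)%:R - B * derive1 (Fq (2 * n + 1)) B / Fq (2 * n + 1) B = 0.
Context {d : measure_display} {Omega : measurableType d}.
Variables (P : probability Omega R) (W : R -> Omega -> R) (hW : is_std_BM P W).
Variables (t x : R) (ht0 : 0 <= t) (ht1 : t < 1).
Variables (X : R -> Omega -> R) (hX : is_bridge W t x X).

Let k := (2 * n)%N.
Let hBk : (k.+1)%:R - B * derive1 (Fq k.+1) B / Fq k.+1 B = 0.
Proof. by move: hB; rewrite addn1. Qed.

Let T (j : nat) : R := 1 - (1 - t) / (2 ^ j)%:R.
Let T_itv j : t <= T j < 1. Proof. exact: horizon_itv. Qed.
Let tT j : t <= T j. Proof. by have /andP[] := T_itv j. Qed.
Let T1 j : T j < 1. Proof. by have /andP[] := T_itv j. Qed.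

Let natfilI s A B' : natfil X t s A -> natfil X t s B' -> natfil X t s (A `&` B').
Proof. exact: (@measurableI _ (g_sigma_algebraType (natgen t X s))). Qed.

Let natfilC s A : natfil X t s A -> natfil X t s (~` A).
Proof. exact: (@measurableC _ (g_sigma_algebraType (natgen t X s))). Qed.

Let natfilU s A B' : natfil X t s A -> natfil X t s B' -> natfil X t s (A `|` B').
Proof. exact: (@measurableU _ (g_sigma_algebraType (natgen t X s))). Qed.

(* [b = true]: stop at [tau2] if [X] is nonpositive at [tau1], else at [tau1];
   [b = false]: the opposite choice. *)
Definition switch (b : bool) (tau1 tau2 : Omega -> R) (w : Omega) : R :=
  let r := maxr (tau1 w) t in
  if (X r w <= 0) == b then maxr r (tau2 w) else r.

Lemma switch_stopping b tau1 tau2 :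
  is_stopping_time X t tau1 -> is_stopping_time X t tau2 ->
  is_stopping_time X t (switch b tau1 tau2).
Proof.
move=> h1 h2 s /[dup] s1 /andP[ts s1'].
(* The sign is read at [tau1] clipped to [[t, s]]: this is known at time [s], and it is the right
   sign wherever [tau1 <= s]. *)
pose D := [set w | (X (clip t s (tau1 w)) w <= 0) == b].
have mD : natfil X t s D.
  have mX := measurable_X_clip_natfil hX h1 ts s1'.
  have mD0 : natfil X t s [set w | X (clip t s (tau1 w)) w <= 0].
    have -> : [set w | X (clip t s (tau1 w)) w <= 0] =
        (fun w => X (clip t s (tau1 w)) w) @^-1` `]-oo, 0]%classic.
      by apply/seteqP; split => w /=; rewrite in_itv.
    by have := mX measurableT `]-oo, 0]%classic (measurable_itv _); rewrite setTI.
  rewrite /D; case: b {D}.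
    rewrite (_ : mkset _ = [set w | X (clip t s (tau1 w)) w <= 0])//.
    by apply/seteqP; split => w /=; rewrite eqb_id.
  rewrite (_ : mkset _ = ~` [set w | X (clip t s (tau1 w)) w <= 0]); first exact: natfilC.
  by apply/seteqP; split => w /=; rewrite eqbF_neg => /negP.
rewrite (_ : mkset _ = [set w | tau1 w <= s] `&` ((D `&` [set w | tau2 w <= s]) `|` ~` D)).
  by apply: natfilI; [exact: h1|apply: natfilU; [apply: natfilI => //; exact: h2|exact: natfilC]].
apply/seteqP; split => w; rewrite /switch /D /=.
- case: ifPn => [E|/negP E].
    rewrite !ge_max ts andbT => /andP[t1s t2s]; split => //; left; split => //.
    by rewrite /clip (min_l t1s) maxC.
  rewrite ge_max ts andbT => t1s; split => //; right.
  by rewrite /clip (min_l t1s) maxC.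
- move=> [t1s]; rewrite /clip (min_l t1s) maxC => -[[-> t2s]|/negP/negbTE ->].
    by rewrite !ge_max t1s ts t2s.
  by rewrite ge_max t1s ts.
Qed.

(** Optional stopping holds for parameters of either sign, so the problem for [-X] is that for [X]
    with [-l]; no reflected bridge is introduced. *)
Lemma signed_expm (eps l : R) (tau : Omega -> R) w : (eps == 1) || (eps == -1) ->
  expR (l * (eps * X (tau w) w / (1 - tau w) - eps * x / (1 - t))
     - l ^+ 2 / 2 * ((1 - tau w)^-1 - (1 - t)^-1)) = expm X (eps * l) t (tau w) w.
Proof.
move=> e1; rewrite /expm (bridge_start hX); congr expR.
have -> : (eps * l) ^+ 2 = l ^+ 2.
  by rewrite exprMn; case/orP: e1 => /eqP ->; rewrite ?sqrrN expr1n mul1r.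
by congr (_ - _); rewrite -!mulrA; ring.
Qed.

(** [g] is the lower limit of the rewards stopped at the horizons [T j]: measurable, bounded in mean
    by Fatou's lemma, and equal to the reward at [sigma] wherever [t <= sigma < 1]. *)
Lemma optional_stopping_upper (eps : R) (sigma : Omega -> R) :
  (eps == 1) || (eps == -1) -> is_stopping_time X t sigma ->
  exists g : Omega -> \bar R, [/\ forall w, (0 <= g w)%E, measurable_fun setT g,
    (\int[P]_w g w <= (Uk k B t (eps * x))%:E)%E &
    forall w, t <= sigma w < 1 ->
      g w = (Num.max (eps * X (sigma w) w) 0 ^+ k.+1)%:E].
Proof.
move=> e1 hs.
pose f j w := Num.max (eps * X (clip t (T j) (sigma w)) w) 0 ^+ k.+1.
have f0 j w : 0 <= f j w by rewrite exprn_ge0// le_max lexx orbT.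
have mX j := measurable_X_clip hW ht0 hX hs (tT j) (T1 j).
have mf j : measurable_fun setT (fun w => (f j w)%:E).
  apply/measurable_EFinP; apply: measurable_funX; apply: measurable_maxr => //.
  exact: measurable_funM.
exists (fun w => limn_einf (fun j => (f j w)%:E)); split.
- move=> w; rewrite limn_einf_lim; apply: lime_ge.
    exact: is_cvg_einfs.
  by apply: nearW => j; apply: le_ereal_inf_tmp => _ [i _ <-]; rewrite lee_fin.
- apply: (@emeasurable_fun_cvg _ _ _ _ (fun m w => einfs (fun j => (f j w)%:E) m)).
    by move=> m; exact: (measurable_fun_einfs mf).
  by move=> w _; rewrite limn_einf_lim; exact: is_cvg_einfs.
- apply: le_trans; first by apply: fatou => // j w _; rewrite lee_fin.
  rewrite limn_einf_lim; apply: lime_le.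
    exact: is_cvg_einfs.
  apply: nearW => j; apply: (@le_trans _ _ (\int[P]_w (f j w)%:E)%E).
    by apply: ereal_inf_lbound; exists j => /=.
  apply: (@single_upper _ _ _ B0 hBk _ _ P t (eps * x) ht1 (fun w => clip t (T j) (sigma w))
    (fun w => eps * X (clip t (T j) (sigma w)) w)) => //.
  + exact: (measurable_clip_stop hW ht0 hX hs (tT j) (T1 j)).
  + exact: measurable_funM.
  + by move=> w; have /andP[-> h] := clip_itv (sigma w) (tT j); rewrite (le_lt_trans h).
  + move=> l _; under eq_integral do rewrite (signed_expm _ (fun w => clip t (T j) (sigma w)))//.
    by rewrite (optional_stopping hW ht0 ht1 hX hs (tT j) (T1 j)).
- move=> w /andP[ts s1].
  have fc : (f j w)%:E @[j --> \oo] --> (Num.max (eps * X (sigma w) w) 0 ^+ k.+1)%:E.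
    apply: cvg_near_cst; near=> j.
    rewrite /f clip_id// ts/=; apply/ltW; near: j.
    exact: (cvgr_gt _ (cvg_horizon t) _ s1).
  by rewrite (cvg_limn_einf_sup fc).1.
Unshelve. all: by end_near. Qed.

Lemma expected_payoff_upper tau1 tau2 : admissible P X t tau1 tau2 ->
  (expected_payoff P n X tau1 tau2 <= (Jstar n B t x)%:E)%E.
Proof.
move=> [h1 h2 hae].
have o1 : ((1 : R) == 1) || ((1 : R) == -1) by rewrite eqxx.
have [g1 [g10 mg1 ig1 g1E]] := @optional_stopping_upper 1 _ o1 (switch_stopping true h1 h2).
have oN : ((-1 : R) == 1) || ((-1 : R) == -1) by rewrite eqxx orbT.
have [g2 [g20 mg2 ig2 g2E]] := @optional_stopping_upper (-1) _ oN (switch_stopping false h1 h2).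
rewrite Jstar_Uk// EFinD; apply: (@le_trans _ _ (\int[P]_w (g1 w + g2 w)%E)%E); last first.
  rewrite ge0_integralD//; apply: leeD; first by rewrite -[X in Uk _ _ _ X]mul1r.
  by rewrite -[X in Uk _ _ _ X]mulN1r.
apply: ae_le_integral; [by move=> w; rewrite adde_ge0|exact: emeasurable_funD|].
apply: filterS hae => w [t1 [t12 t2]].
have s1 := le_lt_trans t12 t2; have t2t := le_trans t1 t12.
have odd_opp (y : R) : (- y) ^+ k.+1 = - y ^+ k.+1.
  by rewrite exprNn exprS exprM sqrrN !expr1n !mulr1 mulN1r.
(* An odd power is at most its positive part; this brings the signed payoff under the two one-sided
   rewards. *)
have pos (y : R) : y ^+ k.+1 <= Num.max y 0 ^+ k.+1.
  have [y0|y0] := leP y 0; last by [].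
  have := exprn_ge0 k.+1 (_ : 0 <= - y); rewrite oppr_ge0 odd_opp oppr_ge0 expr0n/=; exact.
have neg (y : R) : - y ^+ k.+1 <= Num.max (- 1 * y) 0 ^+ k.+1.
  by rewrite mulN1r -odd_opp; exact: pos.
have pos1 (y : R) : y ^+ k.+1 <= Num.max (1 * y) 0 ^+ k.+1 by rewrite mul1r.
rewrite g1E ?g2E; [|rewrite /switch (max_l t1) (max_r t12)..]; last 2 first.
- by case: ifP; rewrite ?t1 ?s1 ?t2t ?t2.
- by case: ifP; rewrite ?t1 ?s1 ?t2t ?t2.
rewrite -EFinD lee_fin /payoff /switch (max_l t1) (max_r t12) addn1 -/k eqb_id eqbF_neg.
case: (leP (X (tau1 w) w) 0) => /= _; last by rewrite lerD.
by rewrite lerD.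
Qed.

Definition sigma_hit (eps : R) (w : Omega) : R :=
  hit t (fun s => B * Num.sqrt (1 - s) <= eps * X s w).

Let boundary_continuous (eps : R) w :
  {within `[t, 1[, continuous (fun s => eps * X s w)} /\
  {within `[t, 1[, continuous (fun s => B * Num.sqrt (1 - s))}.
Proof.
have [_ [Xc _]] := hX w; split.
  by move=> s; apply: cvgMr; exact: Xc.
apply: continuous_subspaceT => s; apply: cvgMr.
apply: (@continuous_comp _ _ _ (fun s : R => 1 - s) (@Num.sqrt R)); last exact: sqrt_continuous.
by apply: cvgB; [exact: cvg_cst|exact: cvg_id].
Qed.

Lemma sigma_hit_itv eps w : t <= sigma_hit eps w <= 1.
Proof. by apply: hit_le1; exact: ltW. Qed.

Lemma sigma_hit_attained eps w : sigma_hit eps w < 1 ->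
  B * Num.sqrt (1 - sigma_hit eps w) <= eps * X (sigma_hit eps w) w.
Proof. by have [h1 h2] := boundary_continuous eps w; exact: (hit_attained ht1 h1 h2). Qed.

Lemma sigma_hit_le eps w s : t <= s < 1 -> B * Num.sqrt (1 - s) <= eps * X s w ->
  sigma_hit eps w <= s.
Proof. by move=> s1 h; exact: hit_le. Qed.

Lemma sigma_hit_stopping eps : is_stopping_time X t (sigma_hit eps).
Proof.
move=> s /andP[ts s1].
rewrite (_ : mkset _ = \bigcap_i \bigcup_N \bigcup_(j in [set j | (j <= 2 ^ N)%N])
  (X (grid t s N j) @^-1` [set y | B * Num.sqrt (1 - grid t s N j) - (i.+1%:R)^-1 < eps * y])).
  apply: (@bigcap_measurableType _ (g_sigma_algebraType (natgen t X s))) => i _.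
  apply: (@bigcupT_measurable _ (g_sigma_algebraType (natgen t X s))) => N.
  apply: (@bigcup_measurable _ (g_sigma_algebraType (natgen t X s))) => j jN.
  have /andP[tg gs] := grid_itv ts jN.
  apply: natfil_X => //.
  have : measurable_fun setT (fun y : R => eps * y) by exact: measurable_funM.
  move=> /(_ measurableT _ (measurable_itv `]B * Num.sqrt (1 - grid t s N j) - (i.+1%:R)^-1, +oo[)).
  by rewrite setTI; congr (measurable _); apply/seteqP; split => y /=; rewrite in_itv/= andbT.
apply/seteqP; split => w /=.
  have [h1 h2] := boundary_continuous eps w.
  move=> /(hit_le_grid ht1 h1 h2 ts s1) H i _.
  by have [N [j jN Hj]] := H i; exists N => //; exists j.
move=> H; have [h1 h2] := boundary_continuous eps w.
apply/(hit_le_grid ht1 h1 h2 ts s1) => i.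
by have [N _ [j jN Hj]] := H i I; exists N, j.
Qed.

Let cvg_clip_horizon (u : R) : t <= u <= 1 -> clip t (T j) u @[j --> \oo] --> u.
Proof.
move=> /andP[tu u1]; have [u1'|u1'] := ltP u 1.
  apply: cvg_near_cst; near=> j; rewrite clip_id// tu/=; apply/ltW; near: j.
  exact: (cvgr_gt _ (cvg_horizon t) _ u1').
have -> : u = 1 by apply/eqP; rewrite eq_le u1.
under eq_fun => j do rewrite /clip (min_r (ltW (T1 j))) (max_r (tT j)).
exact: cvg_horizon.
Unshelve. all: by end_near. Qed.

Lemma measurable_sigma_hit eps : measurable_fun setT (sigma_hit eps).
Proof.
have mc j := measurable_clip_stop hW ht0 hX (sigma_hit_stopping eps) (tT j) (T1 j).
exact: (measurable_fun_cvg mc (fun w _ => cvg_clip_horizon (sigma_hit_itv eps w))).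
Qed.

Lemma sigma_hit_boundary eps w : eps * x < B * Num.sqrt (1 - t) -> sigma_hit eps w < 1 ->
  eps * X (sigma_hit eps w) w = B * Num.sqrt (1 - sigma_hit eps w).
Proof.
move=> xB s1; have := sigma_hit_attained s1; have /andP[ts _] := sigma_hit_itv eps w.
have := @sigma_hit_le eps w; set r := sigma_hit eps w in s1 ts *.
move=> hle hr; apply/eqP; rewrite eq_le hr andbT leNgt; apply/negP => lt.
have tr : t < r.
  rewrite lt_neqAle ts andbT; apply/eqP => tr.
  by move: hr; rewrite -tr (bridge_start hX) leNgt xB.
have [h1 h2] := boundary_continuous eps w.
have hc : {within `[t, 1[, continuous (fun s => eps * X s w - B * Num.sqrt (1 - s))}.
  by move=> s; apply: cvgB; [exact: h1|exact: h2].
have rA : `[t, 1[%classic r by rewrite /= in_itv/= ts s1.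
have e0 : 0 < eps * X r w - B * Num.sqrt (1 - r) by rewrite subr_gt0.
have [q q0 H] := within_continuousP hc rA e0.
(* A slightly earlier time, kept after [t] and within the continuity radius: a path strictly above
   the boundary at [r] is above it there too, contradicting that [r] is the first hit. *)
pose s := Num.max t (r - q / 2).
have sr : s < r by rewrite gt_max tr/= gtrDl oppr_lt0 divr_gt0.
have tss : t <= s by rewrite le_max lexx.
have sA : `[t, 1[%classic s by rewrite /= in_itv/= tss (lt_trans sr).
have rs : `|r - s| < q.
  rewrite gtr0_norm ?subr_gt0// ltrBlDl -ltrBlDr (lt_le_trans (_ : _ < r - q / 2))//.
    by rewrite ltrD2l ltrN2 ltr_pdivrMr// ltr_pMr// ltr1n.
  by rewrite le_max lexx orbT.
have := H s sA rs; rewrite ltr_norml => /andP[_ Hs].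
have : r <= s; last by rewrite leNgt sr.
apply: hle; first by rewrite tss (lt_trans sr).
by move: Hs; lra.
Qed.

(** [Y] is a measurable version of the reward: the power of the boundary height at the hitting time,
    or a constant when the start is already on or beyond the boundary and stopping is immediate. *)
Lemma sigma_hit_value (eps : R) : (eps == 1) || (eps == -1) ->
  exists Y : Omega -> R, [/\ forall w, 0 <= Y w, measurable_fun setT Y,
    (\int[P]_w (Y w)%:E = (Uk k B t (eps * x))%:E)%E &
    {ae P, forall w, sigma_hit eps w < 1 /\ (eps * X (sigma_hit eps w) w) ^+ k.+1 = Y w}].
Proof.
move=> e1; have [xB|xB] := ltP (eps * x) (B * Num.sqrt (1 - t)); last first.
  have st w : sigma_hit eps w = t.
    apply/eqP; rewrite eq_le; have /andP[-> _] := sigma_hit_itv eps w.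
    by rewrite andbT; apply: sigma_hit_le; rewrite ?lexx// (bridge_start hX).
  exists (fun=> (eps * x) ^+ k.+1); split => //.
  - by move=> _; rewrite exprn_ge0// (le_trans _ xB)// mulr_ge0 ?(ltW B0)// sqrtr_ge0.
  - by rewrite /Uk ltNge xB/= integral_cst// [X in (_ * X)%E]probability_setT mule1.
  - by apply: aeW => w; rewrite st (bridge_start hX).
have mX j := measurable_X_clip hW ht0 hX (sigma_hit_stopping eps) (tT j) (T1 j).
pose zeta j w := eps * X (clip t (T j) (sigma_hit eps w)) w.
have mz j : measurable_fun setT (zeta j) by exact: measurable_funM.
have zeq j w : sigma_hit eps w <= T j -> zeta j w = B * Num.sqrt (1 - sigma_hit eps w).
  move=> sT; have /andP[ts _] := sigma_hit_itv eps w.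
  by rewrite /zeta clip_id ?ts// sigma_hit_boundary// (le_lt_trans sT).
have zle j w : zeta j w <= B * Num.sqrt (1 - clip t (T j) (sigma_hit eps w)).
  have [sT|sT] := leP (sigma_hit eps w) (T j).
    by have /andP[ts _] := sigma_hit_itv eps w; rewrite zeq// clip_id ?ts.
  rewrite /zeta /clip (min_r (ltW sT)) (max_r (tT j)) leNgt; apply/negP => /ltW h.
  by have := sigma_hit_le (T_itv j) h; rewrite leNgt sT.
have He j l : (\int[P]_w (expR (l * (zeta j w / (1 - clip t (T j) (sigma_hit eps w)) - eps * x / (1 - t))
     - l ^+ 2 / 2 * ((1 - clip t (T j) (sigma_hit eps w))^-1 - (1 - t)^-1)))%:E = 1)%E.
  under eq_integral do rewrite (signed_expm _ (fun w => clip t (T j) (sigma_hit eps w)))//.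
  by rewrite (optional_stopping hW ht0 ht1 hX (sigma_hit_stopping eps) (tT j) (T1 j)).
have ms := measurable_sigma_hit eps.
exists (fun w => (B * Num.sqrt (1 - sigma_hit eps w)) ^+ k.+1); split.
- by move=> w; rewrite exprn_ge0// mulr_ge0 ?(ltW B0)// sqrtr_ge0.
- apply: measurable_funX; apply: measurable_funM => //.
  by apply: measurable_fun_sqrt; exact: measurable_funB.
- exact: (@attained_value _ k _ B0 _ _ P _ _ ht1 _ _ xB ms mz (sigma_hit_itv eps) zle zeq He).
- have h := attained_early ht1 ms mz (sigma_hit_itv eps) zle zeq He.
  exists [set w | ~ sigma_hit eps w < 1]; split.
  + rewrite (_ : mkset _ = ~` (sigma_hit eps @^-1` `]-oo, 1[%classic)).
      by apply: measurableC; rewrite -[X in measurable X]setTI; exact: ms.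
    by apply/seteqP; split => w /=; rewrite in_itv.
  + rewrite (_ : mkset _ = ~` [set w | sigma_hit eps w < 1])//.
    rewrite probability_setC ?h ?subee//.
    rewrite (_ : mkset _ = sigma_hit eps @^-1` `]-oo, 1[%classic).
      by rewrite -[X in measurable X]setTI; exact: ms.
    by apply/seteqP; split => w /=; rewrite in_itv.
  + by move=> w /= nw s1; apply: nw; rewrite sigma_hit_boundary.
Qed.

Lemma tau1star_sigma w : tau1star B t X w = Num.min (sigma_hit 1 w) (sigma_hit (-1) w).
Proof.
have bnd (C : R -> Prop) : hit t C <= 1 by have /andP[] := hit_le1 C (ltW ht1).
apply/eqP; rewrite eq_le le_min; apply/andP; split.
  apply/andP; split; apply: hit_ge => [|s s1 h]; do [exact: bnd|apply: hit_le => //; apply: (le_trans h)].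
    by rewrite mul1r ler_norm.
  by rewrite mulN1r -normrN ler_norm.
apply: hit_ge; first by rewrite ge_min bnd.
move=> s s1; rewrite ler_normr => /orP[h|h]; rewrite ge_min; apply/orP.
  by left; apply: hit_le => //; rewrite mul1r.
by right; apply: hit_le => //; rewrite mulN1r.
Qed.

(** Once one boundary has been hit, the second stage waits for the opposite one. That hit, counted
    from [t], cannot precede [tau1star], so [hit_shift] applies. *)
Lemma tau2star_sigma w : tau2star B t X w = Num.max (sigma_hit 1 w) (sigma_hit (-1) w).
Proof.
rewrite /tau2star tau1star_sigma.
have /andP[tp p1] := sigma_hit_itv 1 w; have /andP[tm m1] := sigma_hit_itv (-1) w.
set r := Num.min _ _.
have tr : t <= r by rewrite le_min tp tm.
have rp : r <= sigma_hit 1 w by rewrite ge_min lexx.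
have rm : r <= sigma_hit (-1) w by rewrite ge_min lexx orbT.
have -> : hit r (fun s => B * Num.sqrt (1 - s) <= X s w) = sigma_hit 1 w.
  have E : sigma_hit 1 w = hit t (fun s => B * Num.sqrt (1 - s) <= X s w).
    by congr hit; apply/funext => s; rewrite mul1r.
  by rewrite E in rp *; exact: hit_shift.
have -> : hit r (fun s => X s w <= - (B * Num.sqrt (1 - s))) = sigma_hit (-1) w.
  have E : sigma_hit (-1) w = hit t (fun s => X s w <= - (B * Num.sqrt (1 - s))).
    by congr hit; apply/funext => s; rewrite mulN1r lerNr.
  by rewrite E in rm *; exact: hit_shift.
(* If neither boundary is hit before 1, both hitting times are 1 by convention and the two branches
   coincide. *)
have [r1|r1] := ltP r 1; last first.
  have pE : sigma_hit 1 w = 1 by apply/eqP; rewrite eq_le p1 (le_trans r1).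
  have mE : sigma_hit (-1) w = 1 by apply/eqP; rewrite eq_le m1 (le_trans r1).
  by rewrite pE mE; case: ifP; rewrite maxxx.
case: ifPn => [h|/negP h].
  have : sigma_hit (-1) w <= r by apply: sigma_hit_le; rewrite ?tr// mulN1r lerNr.
  by move=> mr; rewrite max_l// (le_trans mr).
have [pm|mp] := leP (sigma_hit 1 w) (sigma_hit (-1) w); first by [].
exfalso; apply: h; have rE : r = sigma_hit (-1) w by rewrite /r min_r// ltW.
rewrite rE in r1 *; have := sigma_hit_attained r1.
by rewrite mulN1r lerNr.
Qed.

Lemma early_sigma : {ae P, forall w, sigma_hit 1 w < 1 /\ sigma_hit (-1) w < 1}.
Proof.
have o1 : ((1 : R) == 1) || ((1 : R) == -1) by rewrite eqxx.
have oN : ((-1 : R) == 1) || ((-1 : R) == -1) by rewrite eqxx orbT.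
have [Y1 [_ _ _ h1]] := sigma_hit_value o1; have [Y2 [_ _ _ h2]] := sigma_hit_value oN.
by apply: filterS2 h1 h2 => w [? _] [].
Qed.

Lemma optimal_admissible : admissible P X t (tau1star B t X) (tau2star B t X).
Proof.
split.
- move=> s s1.
  rewrite (_ : mkset _ = [set w | sigma_hit 1 w <= s] `|` [set w | sigma_hit (-1) w <= s]).
    by apply: natfilU; exact: sigma_hit_stopping.
  by apply/seteqP; split => w /=; rewrite tau1star_sigma ge_min => /orP.
- move=> s s1.
  rewrite (_ : mkset _ = [set w | sigma_hit 1 w <= s] `&` [set w | sigma_hit (-1) w <= s]).
    by apply: natfilI; exact: sigma_hit_stopping.
  by apply/seteqP; split => w /=; rewrite tau2star_sigma ge_max => /andP.
- apply: filterS early_sigma => w [p1 m1]; rewrite tau1star_sigma tau2star_sigma.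
  have /andP[tp _] := sigma_hit_itv 1 w; have /andP[tm _] := sigma_hit_itv (-1) w.
  by rewrite le_min tp tm gt_max p1 m1 ge_min le_max lexx.
Qed.

Lemma expected_payoff_optimal :
  expected_payoff P n X (tau1star B t X) (tau2star B t X) = (Jstar n B t x)%:E.
Proof.
have o1 : ((1 : R) == 1) || ((1 : R) == -1) by rewrite eqxx.
have oN : ((-1 : R) == 1) || ((-1 : R) == -1) by rewrite eqxx orbT.
have [Y1 [Y10 mY1 iY1 h1]] := sigma_hit_value o1.
have [Y2 [Y20 mY2 iY2 h2]] := sigma_hit_value oN.
rewrite mul1r in iY1; rewrite mulN1r in iY2.
rewrite Jstar_Uk// EFinD -iY1 -iY2 -ge0_integralD//; last 4 first.
- by move=> w _; rewrite lee_fin.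
- exact/measurable_EFinP.
- by move=> w _; rewrite lee_fin.
- exact/measurable_EFinP.
apply: ae_eq_integral_ge0.
- by move=> w; rewrite adde_ge0// lee_fin.
- by apply: emeasurable_funD; exact/measurable_EFinP.
apply: filterS2 h1 h2 => w [p1 <-] [m1 <-]; rewrite -EFinD; congr EFin.
rewrite !mul1r !mulN1r -/(GRing.opp _) /payoff tau1star_sigma tau2star_sigma addn1 -/k.
have odd_opp (y : R) : (- y) ^+ k.+1 = - y ^+ k.+1.
  by rewrite exprNn exprS exprM sqrrN !expr1n !mulr1 mulN1r.
have bpos u : u < 1 -> 0 < B * Num.sqrt (1 - u) by move=> u1; rewrite mulr_gt0// sqrtr_gt0 subr_gt0.
have ap := sigma_hit_attained p1; have am := sigma_hit_attained m1.
rewrite mul1r in ap; rewrite mulN1r in am; rewrite odd_opp.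
(* The sign of X at the earlier hit tells which boundary was reached. In either order the payoff is
   the power at the upper hit minus the power at the lower one. *)
have [pm|mp] := leP (sigma_hit 1 w) (sigma_hit (-1) w).
  by rewrite ifF//; apply/negbTE; rewrite -ltNge (lt_le_trans _ ap)// bpos.
by rewrite ifT// -oppr_ge0 (le_trans _ am)// ltW// bpos.
Qed.

End optimal_switching.

Theorem theorem4p7 (R : realType) (n : nat) (Bs : R)
  (hBs_pos : 0 < Bs)
  (hBs : (2 * n + 1)%:R - Bs * derive1 (Fq (2 * n + 1)) Bs / Fq (2 * n + 1) Bs = 0)
  (d : measure_display) (Omega : measurableType d) (P : probability Omega R)
  (W : R -> Omega -> R) (hW : is_std_BM P W)
  (t x : R) (ht0 : 0 <= t) (ht1 : t < 1)
  (X : R -> Omega -> R) (hX : is_bridge W t x X) :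
  Jvalue P n X t = (Jstar n Bs t x)%:E /\
  admissible P X t (tau1star Bs t X) (tau2star Bs t X) /\
  expected_payoff P n X (tau1star Bs t X) (tau2star Bs t X) = Jvalue P n X t.
Proof.
have adm := optimal_admissible n hBs_pos hW ht0 ht1 hX.
have opt := expected_payoff_optimal n hBs_pos hW ht0 ht1 hX.
have JE : Jvalue P n X t = (Jstar n Bs t x)%:E.
  apply/eqP; rewrite eq_le; apply/andP; split.
    apply: ge_ereal_sup => _ [tau1 [tau2 [h ->]]].
    exact: (expected_payoff_upper hBs_pos hBs hW ht0 ht1 hX h).
  by apply: ereal_sup_ubound; exists (tau1star Bs t X), (tau2star Bs t X).
by rewrite JE.
Qed.
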